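(* Let $a\in\mathbb Q_3$ with $|a-2|_3\le1/9$, and define $\phi=\phi_{a,3}:\mathbb Q_3^2\to\mathbb Q_3^2$ by $\phi(x,y)=(a+3y-x^2,x)$. (a) $B_{1/3}(1,1)$ is fixed by $\phi$ (i.e. $\phi(B_{1/3}(1,1))\subseteq B_{1/3}(1,1)$) and the other eight balls of radius $1/3$ in $B_1(0,0)$ are strictly preperiodic. For each $k\ge1$, there is a cycle of balls of radius $1/3^{k+1}$ in $B_{1/3}(1,1)$ of minimal period $3^k$, and all other balls of radius $1/3^{k+1}$ in $B_{1/3}(1,1)$ are strictly preperiodic. Moreover, each periodic ball of radius $1/3^k$ contains exactly three periodic balls of radius $1/3^{k+1}$. (b) The attractor $J(\phi)$ is uncountably infinite, has Haar measure zero in $\mathbb Q_3^2$, and contains no periodic points. Each point of $J(\phi)$ has dense forward orbit in $J(\phi)$. In particular, $J(\phi)$ is indecomposable. (c) There exists a probability measure $\mu_\phi$ supported on $J(\phi)$ such that for all $(x,y)\in B_1(0,0)$ and all continuous $f:B_1(0,0)\to\mathbb R$, $$\lim_{n\to+\infty}\frac1n\sum_{i=1}^n f(\phi^i(x,y))=\int f\,d\mu_\phi.$$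
   Context: $|\cdot|_3$ is the $3$-adic absolute value on $\mathbb Q_3$ with $|3|_3=1/3$. $\|(x,y)\|=\max(|x|_3,|y|_3)$ and $B_r(c_1,c_2)=\{(x,y)\in\mathbb Q_3^2:\|(x,y)-(c_1,c_2)\|\le r\}$, so $B_1(0,0)=\mathbb Z_3^2$. $\phi$ maps $B_1(0,0)$ into itself and $\phi^n(B_r(x,y))\subseteq B_r(\phi^n(x,y))$ for balls in $B_1(0,0)$; by abuse of notation $\phi^n(B_r(x,y))$ also denotes the ball $B_r(\phi^n(x,y))$. A ball $B\subseteq B_1(0,0)$ is periodic if $\phi^n(B)\subseteq B$ for some $n\ge1$, the least such $n$ being its minimal period, and the balls $B,\phi(B),\dots,\phi^{n-1}(B)$ form its cycle; a ball that is not periodic is strictly preperiodic. $J(\phi)$ is the set of points of $\mathbb Q_3^2$ whose two-sided orbit $\{\phi^n(x,y):n\in\mathbb Z\}$ is bounded. An attractor for a homeomorphism $\phi$ of a metric space $(M,d)$ is a nonempty compact $\mathcal A$ with $\phi(\mathcal A)=\mathcal A$ such that some open $U$ properly containing $\mathcal A$ satisfies $\min_{\alpha\in\mathcal A}d(\phi^n(\beta),\alpha)\to0$ for all $\beta\in U$; it is indecomposable if it is not a disjoint union of two attractors. *)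

(* Defs.v *)
From HB Require Import structures.
From mathcomp Require Import all_boot all_order all_algebra.
From mathcomp Require Import all_classical all_reals all_analysis.
From mathcomp Require Import ring.

Set Implicit Arguments.
Unset Strict Implicit.
Unset Printing Implicit Defensive.

Import Order.TTheory GRing.Theory Num.Theory.
Import numFieldNormedType.Exports.

Local Open Scope classical_set_scope.
Local Open Scope ring_scope.

(* Z_3 is the inverse limit of the rings Z/3^n.  An element is the sequence of
   its residues, the n-th one being represented in {0, ..., 3^n - 1}. *)
Definition coherent (x : nat -> int) : Prop :=
  forall n, (x n.+1 %% 3 ^+ n)%Z = x n.

Record Z3 := MkZ3 { res3 :> nat -> int; res3P : coherent res3 }.

HB.instance Definition _ := gen_eqMixin Z3.
HB.instance Definition _ := gen_choiceMixin Z3.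

Lemma Z3_ext (x y : Z3) : (forall n, x n = y n) -> x = y.
Proof.
case: x y => [x xP] [y yP] /= /funext xy; subst y.
by rewrite (Prop_irrelevance xP yP).
Qed.

Lemma expz3_neq0 n : (3 : int) ^+ n != 0.
Proof. by rewrite expf_neq0. Qed.

Lemma expz3_gt0 n : (0 : int) < 3 ^+ n.
Proof. by rewrite exprn_gt0. Qed.

Lemma modz_exp3 (z : int) m n : (m <= n)%N ->
  ((z %% 3 ^+ n)%Z %% 3 ^+ m)%Z = (z %% 3 ^+ m)%Z.
Proof.
move=> mn; rewrite [in RHS](divz_eq z (3 ^+ n)).
move: (z %/ _)%Z (z %% 3 ^+ n)%Z => q r.
by rewrite -(subnK mn) exprD mulrA modzMDl.
Qed.

Lemma res3_mod (x : Z3) n : (x n %% 3 ^+ n)%Z = x n.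
Proof. by rewrite -(res3P x n) modz_mod. Qed.

Lemma Z3_of_subproof (f : nat -> int) :
  (forall n, (f n.+1 %% 3 ^+ n)%Z = (f n %% 3 ^+ n)%Z) ->
  coherent (fun n => (f n %% 3 ^+ n)%Z).
Proof. by move=> fP n; rewrite modz_exp3. Qed.

Definition Z3_of f fP := MkZ3 (@Z3_of_subproof f fP).

Lemma res3S (x : Z3) n : (x n.+1 %% 3 ^+ n)%Z = (x n %% 3 ^+ n)%Z.
Proof. by rewrite res3P res3_mod. Qed.

Lemma Z3_int_subproof (m : int) n : (m %% 3 ^+ n)%Z = (m %% 3 ^+ n)%Z.
Proof. by []. Qed.

Definition Z3_int (m : int) : Z3 := Z3_of (Z3_int_subproof m).

Lemma Z3_opp_subproof (x : Z3) n :
  (- x n.+1 %% 3 ^+ n)%Z = (- x n %% 3 ^+ n)%Z.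
Proof. by rewrite -modzNm res3S modzNm. Qed.

Definition Z3_opp (x : Z3) : Z3 := Z3_of (Z3_opp_subproof x).

Lemma Z3_add_subproof (x y : Z3) n :
  ((x n.+1 + y n.+1) %% 3 ^+ n)%Z = ((x n + y n) %% 3 ^+ n)%Z.
Proof. by rewrite -modzDm !res3S modzDm. Qed.

Definition Z3_add (x y : Z3) : Z3 := Z3_of (Z3_add_subproof x y).

Lemma Z3_mul_subproof (x y : Z3) n :
  ((x n.+1 * y n.+1) %% 3 ^+ n)%Z = ((x n * y n) %% 3 ^+ n)%Z.
Proof. by rewrite -modzMm !res3S modzMm. Qed.

Definition Z3_mul (x y : Z3) : Z3 := Z3_of (Z3_mul_subproof x y).

Lemma Z3_addA : associative Z3_add.
Proof. by move=> x y z; apply: Z3_ext => n /=; rewrite modzDmr modzDml addrA. Qed.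

Lemma Z3_addC : commutative Z3_add.
Proof. by move=> x y; apply: Z3_ext => n /=; rewrite addrC. Qed.

Lemma Z3_add0 : left_id (Z3_int 0) Z3_add.
Proof. by move=> x; apply: Z3_ext => n /=; rewrite modzDml add0r res3_mod. Qed.

Lemma Z3_addN : left_inverse (Z3_int 0) Z3_opp Z3_add.
Proof. by move=> x; apply: Z3_ext => n /=; rewrite modzDml addNr. Qed.

HB.instance Definition _ :=
  GRing.isZmodule.Build Z3 Z3_addA Z3_addC Z3_add0 Z3_addN.

Lemma Z3_mulA : associative Z3_mul.
Proof. by move=> x y z; apply: Z3_ext => n /=; rewrite modzMmr modzMml mulrA. Qed.

Lemma Z3_mulC : commutative Z3_mul.
Proof. by move=> x y; apply: Z3_ext => n /=; rewrite mulrC. Qed.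

Lemma Z3_mul1 : left_id (Z3_int 1) Z3_mul.
Proof. by move=> x; apply: Z3_ext => n /=; rewrite modzMml mul1r res3_mod. Qed.

Lemma Z3_mulDl : left_distributive Z3_mul Z3_add.
Proof.
by move=> x y z; apply: Z3_ext => n /=; rewrite modzMml modzDm mulrDl.
Qed.

Lemma Z3_1neq0 : Z3_int 1 != 0.
Proof. by apply/eqP => /(congr1 (fun x : Z3 => x 1%N)). Qed.

HB.instance Definition _ :=
  GRing.Zmodule_isComNzRing.Build Z3 Z3_mulA Z3_mulC Z3_mul1 Z3_mulDl Z3_1neq0.

Lemma res3_0 n : (0 : Z3) n = 0. Proof. by rewrite /= mod0z. Qed.

Lemma res3D (x y : Z3) n : (x + y) n = ((x n + y n) %% 3 ^+ n)%Z.
Proof. by []. Qed.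

Lemma res3N (x : Z3) n : (- x) n = (- x n %% 3 ^+ n)%Z.
Proof. by []. Qed.

Lemma res3M (x y : Z3) n : (x * y) n = ((x n * y n) %% 3 ^+ n)%Z.
Proof. by []. Qed.

Lemma res3_nat k n : (k%:R : Z3) n = (k%:Z %% 3 ^+ n)%Z.
Proof.
elim: k => [|k IH]; first by rewrite res3_0 mod0z.
by rewrite mulrS res3D IH modzDm -PoszD.
Qed.

Lemma Z3_neq0P (x : Z3) : x != 0 -> exists n, x n != 0.
Proof.
move=> x0; apply: contrapT => /forallNP xn0; move/eqP: x0; apply.
by apply: Z3_ext => n; rewrite res3_0; have /negP/negPn/eqP := xn0 n.
Qed.

(* The 3-adic valuation of x <> 0 is the largest n such that x = 0 mod 3^n;
   the junk value at 0 is 0. *)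
Definition val3 (x : Z3) : nat :=
  if pselect (exists n, x n != 0) is left h then (ex_minn h).-1 else 0%N.

Lemma res3_le (x : Z3) m n : (m <= n)%N -> (x n %% 3 ^+ m)%Z = x m.
Proof.
move=> /subnK <-; elim: (n - m)%N => [|k IH]; first exact: res3_mod.
by rewrite -IH addSn -(res3P x (k + m)) modz_exp3 ?leq_addl.
Qed.

Lemma val3P (x : Z3) : x != 0 -> x (val3 x) = 0 /\ x (val3 x).+1 != 0.
Proof.
move=> /Z3_neq0P xn; rewrite /val3; case: pselect => // h.
case: ex_minnP => -[|m] xm0 mmin /=.
  by move: xm0; rewrite -(res3_mod x 0) expr0 modz1 eqxx.
split=> //; apply: contrapT => /eqP /mmin; by rewrite ltnn.
Qed.

Lemma val3_unique (x : Z3) k : x k = 0 -> x k.+1 != 0 -> x != 0 /\ val3 x = k.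
Proof.
move=> xk xk1; have x0 : x != 0.
  by apply: contra_neq xk1 => ->; rewrite res3_0.
split=> //; have [v0 v1] := val3P x0.
have res0 m n : (m <= n)%N -> x n = 0 -> x m = 0.
  by move=> mn xn; rewrite -(res3_le x mn) xn mod0z.
apply/eqP; rewrite eqn_leq; apply/andP; split; rewrite leqNgt; apply/negP => lt.
- by move/eqP: xk1; apply; exact: res0 lt v0.
- by move/eqP: v1; apply; exact: res0 lt xk.
Qed.

Lemma val3_res (x : Z3) n : x != 0 -> (val3 x < n)%N ->
  exists2 q : int, x n = 3 ^+ val3 x * q & ~~ (3 %| q)%Z.
Proof.
move=> x0 vn; have [v0 v1] := val3P x0.
have := res3_le x (ltnW vn); rewrite v0 => /dvdz_mod0P/dvdzP[q xq].
exists q; first by rewrite mulrC.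
apply/negP => /dvdzP[r qr]; move/eqP: v1; apply; rewrite -(res3_le x vn).
by rewrite xq qr -mulrA -exprS modzMl.
Qed.

Lemma val3_mulP (x y : Z3) : x != 0 -> y != 0 ->
  x * y != 0 /\ val3 (x * y) = (val3 x + val3 y)%N.
Proof.
move=> x0 y0; set N := (val3 x + val3 y)%N.
have [q xq q3] := @val3_res x N.+1 x0 (leq_addr _ _).
have [r yr r3] := @val3_res y N.+1 y0 (leq_addl _ _).
have xyN : (x N.+1 * y N.+1) = q * r * 3 ^+ N.
  by rewrite xq yr exprD; ring.
apply: val3_unique; last first.
  rewrite res3M xyN; apply/negP => /eqP/dvdz_mod0P.
  rewrite exprS dvdz_mul2r ?expz3_neq0// => qr3.
  have : (3 %| `|q| * `|r|)%N by rewrite -abszM.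
  by rewrite Euclid_dvdM// => /orP[] h; [move: q3|move: r3]; rewrite dvdzE h.
by rewrite -(res3P (x * y) N) res3M xyN modz_exp3 // modzMl.
Qed.

Lemma Z3_mulf_eq0 (x y : Z3) : x * y = 0 -> (x == 0) || (y == 0).
Proof.
move=> xy0; apply/negPn; rewrite negb_or; apply/negP => /andP[x0 y0].
by have [] := val3_mulP x0 y0; rewrite xy0 eqxx.
Qed.

Definition Z3_unit : {pred Z3} := fun x => `[< exists y, y * x = 1 >].

Definition Z3_inv (x : Z3) : Z3 :=
  if pselect (exists y, y * x = 1) is left h then projT1 (cid h) else x.

Lemma Z3_mulVx : {in Z3_unit, left_inverse 1 Z3_inv *%R}.
Proof.
move=> x /asboolP xu; rewrite /Z3_inv; case: pselect => // h.
by case: cid.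
Qed.

Lemma Z3_unitPl (x y : Z3) : y * x = 1 -> Z3_unit x.
Proof. by move=> yx; apply/asboolP; exists y. Qed.

Lemma Z3_inv_out : {in [predC Z3_unit], Z3_inv =1 id}.
Proof.
move=> x /negP xu; rewrite /Z3_inv; case: pselect => // h.
by exfalso; apply: xu; apply/asboolP.
Qed.

HB.instance Definition _ :=
  GRing.ComNzRing_hasMulInverse.Build Z3 Z3_mulVx Z3_unitPl Z3_inv_out.
HB.instance Definition _ :=
  GRing.ComUnitRing_isIntegral.Build Z3 Z3_mulf_eq0.

Lemma res3_sum (x y : Z3) n : x n = 0 -> y n = 0 -> (x + y) n = 0.
Proof. by move=> xn yn; rewrite res3D xn yn addr0 mod0z. Qed.

Lemma val3_max (x : Z3) n : x != 0 -> x n = 0 -> (n <= val3 x)%N.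
Proof.
move=> x0 xn; rewrite leqNgt; apply/negP => vn; have [_ /negP] := val3P x0; apply.
by rewrite -(res3_le x vn) xn mod0z.
Qed.

Lemma val3_res0 (x : Z3) n : x != 0 -> (n <= val3 x)%N -> x n = 0.
Proof.
by move=> x0 nv; have [v0 _] := val3P x0; rewrite -(res3_le x nv) v0 mod0z.
Qed.

Lemma val3_add (x y : Z3) : x != 0 -> y != 0 -> x + y != 0 ->
  (minn (val3 x) (val3 y) <= val3 (x + y)%R)%N.
Proof.
move=> x0 y0 xy0; apply: val3_max => //.
by apply: res3_sum; apply: val3_res0 => //; rewrite ?geq_minl ?geq_minr.
Qed.

Local Notation "x %:F" := (@FracField.tofrac _ x) (format "x %:F").

Definition num3 (q : {fraction Z3}) : Z3 := (frac (repr q)).1.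
Definition den3 (q : {fraction Z3}) : Z3 := (frac (repr q)).2.

Lemma den3_neq0 q : den3 q != 0.
Proof. exact: denom_ratioP. Qed.

Lemma Z3_frac_repr (q : {fraction Z3}) :
  q = ((num3 q))%:F / ((den3 q))%:F.
Proof.
suff: q * ((den3 q))%:F = ((num3 q))%:F.
  by move=> <-; rewrite mulfK // tofrac_eq0 den3_neq0.
rewrite /num3 /den3 -{1}(reprK q); set z := repr q; unlock FracField.tofrac.
rewrite -[LHS]FracField.pi_mul; apply/eqmodP.
rewrite /= FracField.equivfE /FracField.mulf !numden_Ratio ?mulf_neq0 ?oner_eq0 ?denom_ratioP //.
all: by rewrite !mulr1 // mulrC.
Qed.

(* Q_3 is the field of fractions of Z_3.  The parameter R is the field of reals
   in which the absolute value and the distance take their values. *)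
Definition Q3 (R : realType) : Type := {fraction Z3}.

HB.instance Definition _ (R : realType) := GRing.Field.on (Q3 R).
HB.instance Definition _ (R : realType) := isPointed.Build (Q3 R) 0.

Section abs3.
Variable R : realType.

Definition absZ3 (x : Z3) : R := if x == 0 then 0 else 3 ^- val3 x.

Definition abs3 (q : Q3 R) : R :=
  absZ3 (num3 q) / absZ3 (den3 q).

Lemma absZ3_0 : absZ3 0 = 0. Proof. by rewrite /absZ3 eqxx. Qed.

Lemma absZ3_eq0 x : (absZ3 x == 0) = (x == 0).
Proof.
by rewrite /absZ3; case: ifP; rewrite ?eqxx // invr_eq0 expf_eq0 pnatr_eq0 andbF.
Qed.

Lemma absZ3_ge0 x : 0 <= absZ3 x.
Proof. by rewrite /absZ3; case: ifP => // _; rewrite invr_ge0 exprn_ge0. Qed.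

Lemma absZ3M x y : absZ3 (x * y) = absZ3 x * absZ3 y.
Proof.
have [->|x0] := eqVneq x 0; first by rewrite mul0r absZ3_0 mul0r.
have [->|y0] := eqVneq y 0; first by rewrite mulr0 absZ3_0 mulr0.
have [xy0 vxy] := val3_mulP x0 y0.
by rewrite /absZ3 (negbTE x0) (negbTE y0) (negbTE xy0) vxy exprD invfM.
Qed.

Lemma absZ3D x y : absZ3 (x + y) <= Num.max (absZ3 x) (absZ3 y).
Proof.
have [->|x0] := eqVneq x 0; first by rewrite add0r le_max lexx orbT.
have [->|y0] := eqVneq y 0; first by rewrite addr0 le_max lexx.
have [->|xy0] := eqVneq (x + y) 0; first by rewrite absZ3_0 le_max absZ3_ge0.
have := val3_add x0 y0 xy0.
rewrite /absZ3 (negbTE x0) (negbTE y0) (negbTE xy0) geq_min le_max.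
by case/orP => h; apply/orP; [left|right];
  rewrite lef_pV2 ?posrE ?exprn_gt0 // ler_weXn2l // ler1n.
Qed.

Lemma abs3_frac (x y : Z3) : y != 0 ->
  abs3 (x%:F / y%:F) = absZ3 x / absZ3 y.
Proof.
move=> y0; rewrite /abs3; set q : {fraction Z3} := x%:F / y%:F.
have d0 := den3_neq0 q; move: (Z3_frac_repr q).
move: (num3 q) (den3 q) d0 => n d d0 /eqP.
rewrite /q eqr_div ?tofrac_eq0 // -!tofracM tofrac_eq => /eqP /(congr1 absZ3).
by rewrite !absZ3M => xd; apply/eqP; rewrite eqr_div ?absZ3_eq0 // xd.
Qed.

Lemma abs3_0 : abs3 0 = 0.
Proof.
have -> : (0 : Q3 R) = (0%:F / 1%:F : {fraction Z3}) by rewrite tofrac0 mul0r.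
by rewrite abs3_frac ?oner_eq0 // absZ3_0 mul0r.
Qed.

Lemma abs3_ge0 (q : Q3 R) : 0 <= abs3 q.
Proof. by rewrite divr_ge0 ?absZ3_ge0. Qed.

Lemma abs3_eq0 (q : Q3 R) : (abs3 q == 0) = (q == 0).
Proof.
apply/eqP/eqP => [|->]; last exact: abs3_0.
move/eqP; rewrite mulf_eq0 invr_eq0 !absZ3_eq0 (negbTE (den3_neq0 _)) orbF.
by move=> /eqP n0; rewrite [LHS]Z3_frac_repr n0 tofrac0 mul0r.
Qed.

Lemma abs3M (p q : Q3 R) : abs3 (p * q) = abs3 p * abs3 q.
Proof.
have -> : p * q =
   ((num3 p) * (num3 q))%:F
     / ((den3 p) * (den3 q))%:F
    :> {fraction Z3}.
  by rewrite [in LHS](Z3_frac_repr p) [in LHS](Z3_frac_repr q) mulf_div !tofracM.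
by rewrite abs3_frac ?mulf_neq0 ?den3_neq0 // !absZ3M -mulf_div.
Qed.

Lemma absZ3_1 : absZ3 1 = 1.
Proof.
have : absZ3 1 * absZ3 1 = absZ3 1 by rewrite -absZ3M mul1r.
by rewrite -[RHS]mul1r => /mulIf; apply; rewrite absZ3_eq0 oner_eq0.
Qed.

Lemma absZ3N x : absZ3 (- x) = absZ3 x.
Proof.
suff N1 : absZ3 (- 1) = 1 by rewrite -mulN1r absZ3M N1 mul1r.
apply/eqP; rewrite -(@eqrXn2 _ 2) ?absZ3_ge0 //.
by rewrite expr2 -absZ3M mulrNN mul1r absZ3_1 expr1n.
Qed.

Lemma abs3N (q : Q3 R) : abs3 (- q) = abs3 q.
Proof.
have -> : - q =
   (- (num3 q))%:F / ((den3 q))%:F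
    :> {fraction Z3}.
  by rewrite [in LHS](Z3_frac_repr q) tofracN mulNr.
by rewrite abs3_frac ?den3_neq0 // absZ3N.
Qed.

Lemma abs3D (p q : Q3 R) : abs3 (p + q) <= Num.max (abs3 p) (abs3 q).
Proof.
pose n := num3; pose d := den3; have d0 t : d t != 0 := den3_neq0 t.
have ad0 t : absZ3 (d t) != 0 by rewrite absZ3_eq0.
have -> : p + q = (n p * d q + n q * d p)%:F / (d p * d q)%:F :> {fraction Z3}.
  rewrite [in LHS](Z3_frac_repr p) [in LHS](Z3_frac_repr q).
  by rewrite addf_div ?tofrac_eq0 // !(tofracD, tofracM).
rewrite abs3_frac ?mulf_neq0 // ler_pdivrMr; last first.
  by rewrite lt_neqAle eq_sym absZ3_eq0 mulf_neq0 ?absZ3_ge0.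
apply: le_trans (absZ3D _ _) _.
have dpq0 : 0 <= absZ3 (d p * d q) by exact: absZ3_ge0.
rewrite maxr_pMl // ge_max !le_max !absZ3M; apply/andP; split; apply/orP.
- by left; rewrite mulrA divfK.
- by right; rewrite mulrCA mulrC divfK // mulrC.
Qed.

Lemma abs3_3 : abs3 3 = 3^-1.
Proof.
have [n30 v3] : (3 : Z3) != 0 /\ val3 3 = 1%N.
  by apply: val3_unique; rewrite res3_nat.
have -> : (3 : Q3 R) = ((3 : Z3)%:F / 1%:F : {fraction Z3}).
  by rewrite tofrac1 divr1 rmorph_nat.
by rewrite abs3_frac ?oner_eq0 // absZ3_1 divr1 /absZ3 (negbTE n30) v3 expr1.
Qed.

Definition dist3 (p q : Q3 R) : R := abs3 (p - q).

Lemma dist3xx p : dist3 p p = 0.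
Proof. by rewrite /dist3 subrr abs3_0. Qed.

Lemma dist3_eq0 p q : dist3 p q = 0 -> p = q.
Proof. by move/eqP; rewrite abs3_eq0 subr_eq0 => /eqP. Qed.

Lemma dist3C p q : dist3 p q = dist3 q p.
Proof. by rewrite /dist3 -abs3N opprB. Qed.

Lemma dist3_triangle q p r : dist3 p r <= dist3 p q + dist3 q r.
Proof.
rewrite /dist3 -(subrKA q); apply: le_trans (abs3D _ _) _.
by rewrite ge_max lerDl lerDr !abs3_ge0.
Qed.

HB.instance Definition _ :=
  isMetric.Build R (Q3 R) dist3xx dist3_eq0 dist3C dist3_triangle.

End abs3.

Section prod_metric.
Variables (R : realType) (M N : metricType R).

Definition prod_dist (x y : M * N) : R :=
  Num.max (mdist x.1 y.1) (mdist x.2 y.2).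

Lemma prod_dist_ge0 x y : 0 <= prod_dist x y.
Proof. by rewrite le_max mdist_ge0. Qed.

Lemma prod_dist_eq0 x y : prod_dist x y = 0 -> x = y.
Proof.
case: x y => [x1 x2] [y1 y2]; rewrite /prod_dist /= => xy0.
have : mdist x1 y1 <= 0 by rewrite -xy0 le_max lexx.
have : mdist x2 y2 <= 0 by rewrite -xy0 le_max lexx orbT.
rewrite !le_eqVlt !ltNge !mdist_ge0 !orbF.
by move=> /eqP/mdist_positivity -> /eqP/mdist_positivity ->.
Qed.

Lemma ball_prod_dist (x : M * N) d : ball x d = [set y | prod_dist x y < d].
Proof.
apply/seteqP; split=> y; rewrite /ball /= /prod_ball /prod_dist !ballEmdist /=.
  by case=> h1 h2; rewrite gt_max h1 h2.
by rewrite gt_max => /andP[].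
Qed.

HB.instance Definition _ := PseudoMetric_isMetric.Build R (M * N)%type
  prod_dist_ge0 prod_dist_eq0 ball_prod_dist.

End prod_metric.

Notation Q3sq R := (Q3 R * Q3 R)%type.

Notation borel T := (g_sigma_algebraType (@open T)).

Section dynamics.
Variable R : realType.
Implicit Types (z c : Q3sq R) (r : R) (B S : set (Q3sq R)).

Definition norm3 z : R := Num.max (abs3 z.1) (abs3 z.2).

Lemma mdist_norm3 z c : mdist z c = norm3 (z - c).
Proof. by []. Qed.

(* Not the library's closed_ball, which is the closure of the open ball: over
   Q_3 that is again the open ball. *)
Definition cball c r : set (Q3sq R) := [set z | norm3 (z - c) <= r].

Definition unit_ball : set (Q3sq R) := cball (0, 0) 1.

Definition balls_in S r : set (set (Q3sq R)) :=
  [set B | (exists c, B = cball c r) /\ B `<=` S].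

Definition henon (a b : Q3 R) z : Q3sq R := (a + b * z.2 - z.1 ^+ 2, z.1).

Definition henon_inv (a b : Q3 R) z : Q3sq R :=
  (z.2, b^-1 * (z.1 - a + z.2 ^+ 2)).

Lemma henonK (a b : Q3 R) : b != 0 -> cancel (henon a b) (henon_inv a b).
Proof.
move=> b0 [x y]; rewrite /henon_inv /henon /=; congr pair.
by rewrite (_ : _ + x ^+ 2 = b * y) ?mulKf //; ring.
Qed.

Lemma henon_invK (a b : Q3 R) : b != 0 -> cancel (henon_inv a b) (henon a b).
Proof.
move=> b0 [x y]; rewrite /henon_inv /henon /=; congr pair.
by rewrite mulVKf //; ring.
Qed.

Definition henon_iter (a b : Q3 R) (n : int) : Q3sq R -> Q3sq R :=
  match n with
  | Posz n => iter n (henon a b)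
  | Negz n => iter n.+1 (henon_inv a b)
  end.

Definition henonJ (a b : Q3 R) : set (Q3sq R) :=
  [set z | exists M : R, forall n : int, norm3 (henon_iter a b n z) <= M].

Variable phi : Q3sq R -> Q3sq R.

Definition ball_periodic B : Prop :=
  exists2 n, (0 < n)%N & iter n phi @` B `<=` B.

Definition strictly_preperiodic B : Prop := ~ ball_periodic B.

Definition ball_min_period B (n : nat) : Prop :=
  [/\ (0 < n)%N, iter n phi @` B `<=` B &
      forall m, (0 < m)%N -> iter m phi @` B `<=` B -> (n <= m)%N].

(* The image ball phi^i(B_r(c)) is by convention B_r(phi^i(c)). *)
Definition ball_cycle r c (n : nat) : set (set (Q3sq R)) :=
  [set cball (iter i phi c) r | i in `I_n].

End dynamics.

Arguments unit_ball : clear implicits.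

Section attractors.
Variables (R : realType) (M : metricType R) (phi : M -> M).

(* For A compact and nonempty the infimum is a minimum. *)
Definition dist_to (A : set M) (x : M) : R := inf [set mdist x y | y in A].

Definition attractor (A : set M) : Prop :=
  [/\ A !=set0, compact A, phi @` A = A &
      exists U : set M, [/\ open U, A `<` U &
        forall x, U x -> dist_to A (iter n phi x) @[n --> \oo] --> (0 : R)]].

Definition indecomposable (A : set M) : Prop :=
  ~ exists A1 A2, [/\ attractor A1, attractor A2,
                      A1 `&` A2 = set0 & A = A1 `|` A2].

Definition has_dense_forward_orbit_in (A : set M) (x : M) : Prop :=
  A `<=` closure [set iter n phi x | n in [set: nat]].

End attractors.

(* Regularity is automatic because Q_3^2 is a locally compact separable metric
   space. *)
Definition haar_measure (R : realType)
    (nu : {measure set (borel (Q3sq R)) -> \bar R}) : Prop :=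
  [/\ forall (z : Q3sq R) (A : set (borel (Q3sq R))), measurable A ->
        nu [set z + x | x in (A : set (Q3sq R))] = nu A,
      forall K : set (Q3sq R), compact K -> (nu K < +oo)%E &
      nu setT <> 0%E].

(* Main.v *)
From HB Require Import structures.
Require Import Defs.
From mathcomp Require Import all_boot all_order all_algebra.
From mathcomp Require Import all_classical all_reals all_analysis.
From mathcomp Require Import measurable_realfun.
From mathcomp Require Import ring lra zify.

(* In the coordinates (1 + 3u, 1 + 3v) on B_{1/3}(1,1) an orbit is a sequence u in
   Z_3 with u_{n+2} = 1 + 3 al - 2 u_{n+1} + 3 u_n - 3 u_{n+1}^2, where
   a = 2 + 9 al.  The key fact is that, for n large with respect to k,
   u_{n+3^k} - u_n = 3^k e_n with e_n a unit.  It is proved by induction on k: for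
   k >= 1 the recurrence gives e_{n+1} = e_n (1 + 3 u_n) mod 9, and since u_{n+1} =
   u_n + 1 mod 3, e has period 3 mod 9; hence the sum of e_n, e_{n+3^k} and
   e_{n+2.3^k} is 3 e_n mod 9.  Consequently u_n mod 3^k runs through all residues
   with period exactly 3^k.  As the coefficient 3 of u_n makes the past of an orbit
   mod 3^k a function of its present, all orbits are eventually 3^k-near the single
   orbit w of (1,1), and w_n and w_m are 3^k-near exactly when n = m mod 3^k.
   So J is the omega-limit set of w and phi acts on it as the odometer n -> n + 1 of
   Z_3; the invariant measure gives mass 3^-k to each of the 3^k classes. *)

Import Order.TTheory GRing.Theory Num.Theory.
Import numFieldNormedType.Exports.

Local Open Scope classical_set_scope.
Local Open Scope ring_scope.
Local Open Scope card_scope.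

Set Implicit Arguments.
Unset Strict Implicit.
Unset Printing Implicit Defensive.

(** * Divisibility by powers of 3 in Z_3 *)

(** The increments must be known modulo 9 because the next [e] is one third of a sum of three of
    them: seeing that it is a unit takes one digit more than for the summands. The induction cannot
    start at k = 0, since the quadratic term puts 3 * 3^k * e^2 into the recurrence for [e], and
    this vanishes modulo 9 only for k >= 1; hence k = 1 is computed by hand. The bound 2k + 1 on
    indices has one source: the initial values of an orbit are arbitrary, and each level of the
    induction gives up two more indices before its congruences hold. Balls, J and the measure then
    reduce to arithmetic of indices modulo 3^k along w. Whenever an index has to be large, a
    multiple of 3^k is added to it, which is harmless at level k. *)

Definition dvd3 (k : nat) (x : Z3) : Prop := exists c, x = 3 ^+ k * c.

Lemma dvd3_0 k : dvd3 k 0. Proof. by exists 0; rewrite mulr0. Qed.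

Lemma dvd3_0l x : dvd3 0 x. Proof. by exists x; rewrite mul1r. Qed.

Lemma dvd3D {k x y} : dvd3 k x -> dvd3 k y -> dvd3 k (x + y).
Proof. by move=> [c ->] [d ->]; exists (c + d); rewrite mulrDr. Qed.

Lemma dvd3Ml {k} x {y} : dvd3 k y -> dvd3 k (x * y).
Proof. by move=> [c ->]; exists (x * c); rewrite mulrCA. Qed.

Lemma dvd3N {k x} : dvd3 k x -> dvd3 k (- x).
Proof. by move=> /(dvd3Ml (-1)); rewrite mulN1r. Qed.

Lemma dvd3B {k x y} : dvd3 k x -> dvd3 k y -> dvd3 k (x - y).
Proof. by move=> kx /dvd3N; exact: dvd3D. Qed.

Lemma dvd3C {k x y} : dvd3 k (x - y) -> dvd3 k (y - x).
Proof. by move=> /dvd3N; rewrite opprB. Qed.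

Lemma dvd3_trans {k x} y {z} : dvd3 k (x - y) -> dvd3 k (y - z) -> dvd3 k (x - z).
Proof. by move=> xy yz; rewrite -(subrKA y); exact: dvd3D. Qed.

Lemma dvd3W {k x} m : (m <= k)%N -> dvd3 k x -> dvd3 m x.
Proof.
by move=> mk [c ->]; exists (3 ^+ (k - m) * c); rewrite mulrA -exprD subnKC.
Qed.

Lemma dvd3S k x : dvd3 k x -> dvd3 k.+1 (3 * x).
Proof. by move=> [c ->]; exists c; rewrite exprS mulrA. Qed.


Lemma res3_exp k n : ((3 : Z3) ^+ k) n = ((3 ^+ k) %% 3 ^+ n)%Z.
Proof. by rewrite -natrX res3_nat -natz natrX. Qed.

(** The n-th residue of the quotient is the residue of [x] at level n + k divided by 3^k: division
    loses k digits, which an infinite sequence of residues can afford. *)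
Lemma dvd3_res k (x : Z3) : x k = 0 <-> dvd3 k x.
Proof.
split=> [xk|[c ->]]; last by rewrite res3M res3_exp modzz mul0r mod0z.
have dvx n : x (n + k)%N = 3 ^+ k * (x (n + k)%N %/ 3 ^+ k)%Z.
  by rewrite mulrC divzK // dvdzE; apply/dvdz_mod0P; rewrite res3_le ?leq_addl.
have cP : coherent (fun n => (x (n + k)%N %/ 3 ^+ k)%Z).
  move=> n; apply: (mulfI (expz3_neq0 k)); rewrite -dvx.
  by rewrite mulz_modr ?expz3_gt0 // -!dvx -exprD (addnC k) addSn res3P.
exists (MkZ3 cP); apply: Z3_ext => n.
rewrite res3M res3_exp modzMml /= -dvx res3_le ?leq_addr //.
Qed.

Lemma exp3_neq0 k : (3 : Z3) ^+ k != 0.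
Proof.
rewrite expf_neq0 //; apply/eqP => /(congr1 (fun x : Z3 => x 2%N)).
by rewrite res3_nat res3_0.
Qed.

Lemma dvd3_cancel j k x : dvd3 (j + k) (3 ^+ j * x) -> dvd3 k x.
Proof.
by move=> [c]; rewrite exprD -mulrA => /(mulfI (exp3_neq0 j)) ->; exists c.
Qed.

Lemma ndvd31 : ~ dvd3 1 1.
Proof. by move=> /dvd3_res; rewrite (res3_nat 1). Qed.

Lemma modn3P (x : Z3) : exists c : Z3, exists2 i : nat, (i < 3)%N & x = 3 * c + i%:R.
Proof.
pose i := `|x 1%N|%N.
have xi : x 1%N = i%:Z.
  by rewrite /i gez0_abs // -(res3_mod x 1) modz_ge0.
have i3 : (i < 3)%N by rewrite -ltz_nat -xi -(res3_mod x 1) ltz_pmod.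
have /dvd3_res[c xc] : (x - i%:R) 1%N = 0.
  by rewrite res3D res3N res3_nat xi modzDmr -modzDmr -modzNm modz_mod modzNm modzDmr subrr.
by exists c, i => //; rewrite -[LHS](subrK i%:R) xc expr1.
Qed.

(** Bezout inverts [x] modulo each 3^n. Inverses modulo 3^n are unique, so the chosen ones are
    compatible and define an element of the inverse limit. *)
Lemma Z3_unitP (x : Z3) : ~ dvd3 1 x -> exists y, y * x = 1.
Proof.
move=> /dvd3_res x1.
have inv n : exists y : int, (y * x n = 1 %[mod 3 ^+ n])%Z.
  suff /coprimezP[[u v] /= uv] : coprimez (x n) (3 ^+ n).
    by exists u; rewrite (canRL (addrK _) uv) -mulNr addrC modzMDl.
  case: n => [|n]; first by rewrite expr0 coprimezE coprimen1.
  rewrite coprimezXr // coprimez_sym coprimezE prime_coprime //.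
  apply/negP => h; apply: x1.
  by rewrite -(res3_le x (ltn0Sn n)) expr1; apply/dvdz_mod0P; rewrite dvdzE.
have [y yP] := choice inv.
have cy n : (y n.+1 %% 3 ^+ n)%Z = (y n %% 3 ^+ n)%Z.
  have h : (y n.+1 * x n = 1 %[mod 3 ^+ n])%Z.
    rewrite -(res3P x n) modzMmr -(modz_exp3 _ (leqnSn n)) yP.
    by rewrite modz_exp3.
  have -> : (y n.+1 %% 3 ^+ n)%Z = ((y n.+1 * (y n * x n)) %% 3 ^+ n)%Z.
    by rewrite -modzMmr yP modzMmr mulr1.
  by rewrite mulrCA -modzMmr h modzMmr mulr1.
exists (Z3_of cy); apply: Z3_ext => n.
by rewrite res3M /= modzMml yP.
Qed.

(** Residues as natural numbers below 3^k serve for counting with ordinals and for the pigeonhole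
    argument in the proof of compactness. *)
Lemma absz_res_lt (x : Z3) k : (`|x k| < 3 ^ k)%N.
Proof.
rewrite -ltz_nat gez0_abs -(res3_mod x k) ?modz_ge0 ?expz3_neq0 //.
by rewrite (_ : (3 ^ k)%:Z = 3 ^+ k) ?ltz_pmod ?expz3_gt0 // -natz natrX !natz.
Qed.

Lemma absz_res_eq k (x y : Z3) : `|x k|%N = `|y k|%N -> dvd3 k (x - y).
Proof.
have ge0 (t : Z3) : 0 <= t k by rewrite -(res3_mod t k) modz_ge0 ?expz3_neq0.
move=> /(congr1 Posz); rewrite !gez0_abs // => xy; apply/dvd3_res.
by rewrite res3D res3N xy modzDmr subrr mod0z.
Qed.

Section integers.
Variable R : realType.

Lemma abs3_tofrac (x : Z3) : abs3 (FracField.tofrac x : Q3 R) = absZ3 R x.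
Proof.
by rewrite -[X in abs3 X]divr1 -tofrac1 abs3_frac ?oner_eq0 // absZ3_1 divr1.
Qed.

Lemma absZ3_le k (x : Z3) : absZ3 R x <= 3 ^- k <-> dvd3 k x.
Proof.
rewrite -dvd3_res /absZ3; have [->|x0] := eqVneq x 0.
  by rewrite res3_0 invr_ge0 exprn_ge0.
rewrite lef_pV2 ?posrE ?exprn_gt0 // ler_eXn2l ?ltr1n //.
by split=> [|/val3_max]; [exact: val3_res0 | exact].
Qed.

(** Cancelling 3^v, with v the valuation of the denominator, leaves a denominator prime to 3, which
    is a unit of Z_3. *)
Lemma abs3_le1 (q : Q3 R) : abs3 q <= 1 -> exists x : Z3, q = FracField.tofrac x.
Proof.
rewrite /abs3; set n := num3 q; set d := den3 q.
have d0 : d != 0 := den3_neq0 q.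
have qE : q = FracField.tofrac n / FracField.tofrac d := Z3_frac_repr q.
rewrite ler_pdivrMr; last by rewrite lt_def absZ3_eq0 d0 absZ3_ge0.
rewrite mul1r {2}/absZ3 (negbTE d0) => /absZ3_le[n' nE].
have [v0 v1] := val3P d0; have /dvd3_res[d' dE] := v0.
have /Z3_unitP[e ed] : ~ dvd3 1 d'.
  move=> [c cE]; move/eqP: v1; apply; apply/dvd3_res; exists c.
  by rewrite {1}dE cE mulrA -exprD addn1.
exists (n' * e); rewrite qE.
apply: (canLR (mulfK _)); first by rewrite tofrac_eq0.
rewrite -tofracM; congr FracField.tofrac.
move: (val3 d) nE dE => v -> ->.
transitivity (3 ^+ v * n' * (e * d')); [by rewrite ed mulr1 | ring].
Qed.

End integers.

(** * The recurrence satisfied by orbits *)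

Definition henon_seq (al : Z3) (u : nat -> Z3) : Prop :=
  forall n, u n.+2 = 1 + 3 * al - 2 * u n.+1 + 3 * u n - 3 * u n.+1 ^+ 2.

Lemma dvd3_subE {k x y} : dvd3 k (x - y) -> exists c, x = y + 3 ^+ k * c.
Proof. by move=> [c xy]; exists c; rewrite -xy addrC subrK. Qed.

Lemma ndvd31D e s : ~ dvd3 1 e -> ~ dvd3 1 (e + 3 * s).
Proof.
move=> e3 es; apply: e3; rewrite -(addrK (3 * s) e); apply: dvd3B => //.
by exists s; rewrite expr1.
Qed.

(** With x = U i, the three factors multiply to 1 + 3 (x + (x + 1) + (x + 2)) = 1 modulo 9. *)
Lemma dvd9_period3 (e U : nat -> Z3) :
  (forall i, dvd3 2 (e i.+1 - e i * (1 + 3 * U i))) ->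
  (forall i, dvd3 1 (U i.+1 - (U i + 1))) ->
  forall j i, dvd3 2 (e (i + 3 * j)%N - e i).
Proof.
move=> eP UP; elim=> [|j IH] i.
  by rewrite muln0 addn0 subrr; exact: dvd3_0.
rewrite mulnS addnA; apply: (dvd3_trans (IH _)); rewrite addn3.

have [c0 E0] := dvd3_subE (eP i); have [c1 E1] := dvd3_subE (eP i.+1).
have [c2 E2] := dvd3_subE (eP i.+2).
have [r0 V1] := dvd3_subE (UP i); have [r1 V2] := dvd3_subE (UP i.+1).
rewrite E2 E1 E0 V2 V1; set x := U i; set y := e i.
(* The quotient by 9 in the expanded product, the [c] and [r] being the errors in the congruences
   for [e] and [U]. *)
exists (y * (3 + 13 * x + 12 * x ^+ 2 + 3 * x ^+ 3
             + r0 * (1 + 3 * x) * (7 + 3 * x + 9 * (r0 + r1))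
             + (r0 + r1) * (1 + 3 * x) * (4 + 3 * x))
        + c0 * (4 + 3 * x + 9 * r0) * (7 + 3 * x + 9 * (r0 + r1))
        + c1 * (7 + 3 * x + 9 * (r0 + r1)) + c2).
ring.
Qed.

Lemma henon_seq_shift al u m : henon_seq al u -> henon_seq al (fun n => u (n + m)%N).
Proof. by move=> uP n; rewrite !addSn uP. Qed.

Section henon_seq.
Variables (al : Z3) (u : nat -> Z3).
Hypothesis uP : henon_seq al u.

(** Index 0 is excluded because u 0 and u 1 are unrelated initial values. *)
Lemma henon_seq_mod3 n : (0 < n)%N -> dvd3 1 (u n.+1 - (u n + 1)).
Proof.
case: n => // n _; rewrite uP.
by exists (al - u n.+1 + u n - u n.+1 ^+ 2); ring.
Qed.


Lemma henon_seq_period1 n : (3 <= n)%N ->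
  exists2 e, u (n + 3)%N = u n + 3 * e & ~ dvd3 1 e.
Proof.
(* As consecutive terms differ by 1 modulo 3, -2 u_m + 3 u_{m-1} is u_m - 3 modulo 9, which leaves a
   recurrence of order one. *)
have step m : (1 < m)%N -> dvd3 2 (u m.+1 - (u m - 2 + 3 * al - 3 * u m ^+ 2)).
  case: m => [|[|m]] // _; have [s us] := dvd3_subE (@henon_seq_mod3 m.+1 isT).
  by rewrite uP us; exists (- s); ring.
move=> n3; have n1 : (1 < n)%N by apply: leq_trans n3.
have [s0 E0] := dvd3_subE (step _ n1).
have [s1 E1] := dvd3_subE (step n.+1 (ltnW n1)).
have [s2 E2] := dvd3_subE (step n.+2 (ltnW (ltnW n1))).
have [r0 V0] := dvd3_subE (henon_seq_mod3 (ltnW n1)).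
have [r1 V1] := dvd3_subE (@henon_seq_mod3 n.+1 isT).
(* Modulo 9 the three steps add up to -6 - 3 (u^2 + (u + 1)^2 + (u + 2)^2) = -21 = 3 * 2, so the
   increment divided by 3 is 2 modulo 3. *)
exists (2 + 3 * (- 3 + al - u n ^+ 2 - 2 * u n - 2 * r0 * (u n + 1) - 3 * r0 ^+ 2
   - 2 * (r0 + r1) * (u n + 2) - 3 * (r0 + r1) ^+ 2 + s0 + s1 + s2)); last first.
  apply: ndvd31D => -[c c2]; apply: ndvd31; exists (1 - c).
  by rewrite mulrBr -c2; ring.
rewrite addn3 E2; rewrite {1}E1 {1}E0 V1 V0.
ring.
Qed.

Lemma henon_seq_period_step k : (0 < k)%N ->
  (forall n, (k.*2.+1 <= n)%N ->
     exists2 e, u (n + 3 ^ k)%N = u n + 3 ^+ k * e & ~ dvd3 1 e) ->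
  (forall n, (k.+1.*2.+1 <= n)%N ->
     exists2 e, u (n + 3 ^ k.+1)%N = u n + 3 ^+ k.+1 * e & ~ dvd3 1 e).
Proof.
case: k => // k _ IH; set N := (3 ^ k.+1)%N; set b := k.+1.*2.+1 in IH *.
have {}IH i : exists e, u (i + b + N)%N = u (i + b)%N + 3 ^+ k.+1 * e /\ ~ dvd3 1 e.
  by have [//|e ? ?] := IH (i + b)%N; [exact: leq_addl | exists e].
have [e eP] := choice IH.
(* The recurrences at two indices that differ by N are subtracted and divided by 3^(k+1). *)
have eS i : e i.+2 = e i.+1 * (- 2 - 6 * u (i.+1 + b)%N - 9 * 3 ^+ k * e i.+1) + 3 * e i.
  apply: (mulfI (exp3_neq0 k.+1)).
  have := (eP i.+2).1; rewrite !addSn !uP -!addSn (eP i.+1).1 (eP i).1.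
  move=> /esym/(canRL (addKr _)) ->; rewrite !exprS.
  move: (3 ^+ k) (u (i.+1 + b)%N) (u (i + b)%N) (e i.+1) (e i) => x y z t s.
  clear; ring.
have e3 i : dvd3 1 (e i.+2 - e i.+1).
  rewrite eS; exists (e i.+1 * (- 1 - 2 * u (i.+1 + b)%N - 3 * 3 ^+ k * e i.+1) + e i).
  ring.
(* Modulo 9 the quadratic term drops out, -6 u is 3 u, and by [e3] the last term 3 e_{i+1} is 3
   e_{i+2}, so that -2 e + 3 e collapses to e. *)
have e9 i : dvd3 2 (e i.+3 - e i.+2 * (1 + 3 * u (i.+2 + b)%N)).
  have [s es] := dvd3_subE (e3 i); rewrite eS es.
  exists (- (e i.+1 + 3 * s) * (u (i.+2 + b)%N + 3 ^+ k * (e i.+1 + 3 * s)) - s).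
  ring.
have per := @dvd9_period3 (fun i => e i.+2) (fun i => u (i.+2 + b)%N) e9
  (fun i => @henon_seq_mod3 (i.+2 + b) isT).
move=> n nk; pose i := (n - b.+2)%N.
have -> : n = (i.+2 + b)%N by rewrite /i /b; lia.
(* The shifts by N and 2 N are multiples of the period 3 of [e] modulo 9. *)
have [s1 E1] := dvd3_subE (per (3 ^ k)%N i); have [s2 E2] := dvd3_subE (per (2 * 3 ^ k)%N i).
exists (e i.+2 + 3 * (s1 + s2)); last exact: ndvd31D (eP i.+2).2.
have eN j : u (j + b + N)%N = u (j + b)%N + 3 ^+ k.+1 * e j := (eP j).1.
have -> : (i.+2 + b + 3 ^ k.+2 = (i + 3 * (2 * 3 ^ k)).+2 + b + N)%N.
  by rewrite /N !expnS; lia.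
rewrite eN E2.
have -> : ((i + 3 * (2 * 3 ^ k)).+2 + b = (i + 3 * 3 ^ k).+2 + b + N)%N.
  by rewrite /N !expnS; lia.
rewrite eN E1.
have -> : ((i + 3 * 3 ^ k).+2 + b = i.+2 + b + N)%N.
  by rewrite /N !expnS; lia.
rewrite eN (exprS 3 k.+1); move: (3 ^+ k.+1) (u _) (e i.+2) => x y z; ring.
Qed.

Lemma henon_seq_period k n : (k.*2.+1 <= n)%N ->
  exists2 e, u (n + 3 ^ k)%N = u n + 3 ^+ k * e & ~ dvd3 1 e.
Proof.
case: k n => [n n1|k].
  have [s E] := dvd3_subE (henon_seq_mod3 n1).
  exists (1 + 3 * s); last exact: ndvd31D ndvd31.
  by rewrite addn1 E; ring.
elim: k => [|k IH] n nk; last exact: henon_seq_period_step nk.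
by have [e ? ?] := henon_seq_period1 nk; exists e.
Qed.

Lemma henon_seq_periodic k n q : (k.*2.+1 <= n)%N ->
  dvd3 k (u (n + 3 ^ k * q)%N - u n).
Proof.
move=> nk; elim: q => [|q IH]; first by rewrite muln0 addn0 subrr; exact: dvd3_0.
rewrite mulnS (addnC (3 ^ k)%N) addnA.
have [e E _] := @henon_seq_period k (n + 3 ^ k * q)%N (leq_trans nk (leq_addr _ _)).
by rewrite E; apply: dvd3_trans IH; exists e; rewrite addrAC subrr add0r.
Qed.

(** By induction m = 3^k (t + 3 p) with t < 3, and the part in p is a period modulo 3^(k+1). The
    case t = 1 contradicts that the increment is a unit; for t = 2 it is the remaining increment,
    from n + 2 * 3^k to n + 3^(k+1), that would have to vanish. *)
Lemma henon_seq_injective k n m : (k.*2.+1 <= n)%N ->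
  dvd3 k (u (n + m)%N - u n) -> (3 ^ k %| m)%N.
Proof.
elim: k => [|k IH] in n m *; first by rewrite dvd1n.
move=> nk h; have nk' : (k.*2.+1 <= n)%N by lia.
have /dvdnP[q mq] : (3 ^ k %| m)%N by apply: (IH n) => //; exact: dvd3W h.
have [e0 E0 n0] := henon_seq_period nk'.
have qE := divn_eq q 3; have := ltn_pmod q (isT : 0 < 3)%N.
set t := (q %% 3)%N in qE *; set p := (q %/ 3)%N in qE *.
have mE : m = (3 ^ k * t + 3 ^ k.+1 * p)%N by rewrite mq qE expnS; lia.
have {}h : dvd3 k.+1 (u (n + 3 ^ k * t)%N - u n).
  apply: dvd3_trans h; apply: dvd3C; rewrite mE addnA.
  by apply: henon_seq_periodic; apply: leq_trans nk (leq_addr _ _).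
case: t mE h {qE} => [|[|[|t]]] // mE h _.
- by rewrite mE muln0 add0n dvdn_mulr.
- exfalso; apply: n0; apply: (@dvd3_cancel k); rewrite addn1.
  by move: h; rewrite muln1 E0 addrAC subrr add0r.
- exfalso; have n2 : (k.*2.+1 <= n + 3 ^ k * 2)%N by apply: leq_trans nk' (leq_addr _ _).
  have [e E] := henon_seq_period n2; apply; apply: (@dvd3_cancel k); rewrite addn1.
  have := dvd3_trans (henon_seq_periodic 1 nk) (dvd3C h).
  rewrite muln1 expnS -addnA (_ : 3 ^ k * 2 + 3 ^ k = 3 * 3 ^ k)%N in E *; last by lia.
  by rewrite E addrAC subrr add0r.
Qed.

(** The 3^k terms from index m on are pairwise distinct modulo 3^k by [henon_seq_injective], so they
    exhaust the residues. *)
Lemma henon_seq_surjective k (x : Z3) m : (k.*2.+1 <= m)%N ->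
  exists2 j, (m <= j < m + 3 ^ k)%N & dvd3 k (x - u j).
Proof.
move=> mk.
pose f (j : 'I_(3 ^ k)) := Ordinal (absz_res_lt (u (m + j)%N) k).
have f_inj : injective f.
  suff wl (i j : 'I_(3 ^ k)) : (i <= j)%N -> f i = f j -> i = j.
    by move=> i j fij; case: (leqP i j) => [/wl|/ltnW/wl] ->.
  move=> ij /(congr1 val)/= /absz_res_eq/dvd3C.
  rewrite -(subnKC ij) addnA => /(henon_seq_injective).
  move=> /(_ (leq_trans mk (leq_addr _ _))) h.
  apply: val_inj => /=; apply/eqP; rewrite eqn_leq ij /=.
  rewrite -subn_eq0; apply/negPn/negP; rewrite -lt0n => /dvdn_leq/(_ h).
  by have := ltn_ord j; lia.
have [g _ fK] := injF_bij f_inj.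
pose j := g (Ordinal (absz_res_lt x k)).
exists (m + j)%N; first by rewrite leq_addr ltn_add2l ltn_ord.
by apply: absz_res_eq; have /(congr1 val) := fK (Ordinal (absz_res_lt x k)).
Qed.

End henon_seq.

Section two_henon_seqs.
Variables (al : Z3) (u v : nat -> Z3).
Hypotheses (uP : henon_seq al u) (vP : henon_seq al v).

(** As -2 = 1 - 3, a term is its successor plus 3 times an expression in earlier data, so each
    congruence for earlier terms gains one digit. Every digit goes one index further back, hence
    [k <= n]. *)
Lemma henon_seq_dvdB k n : (k <= n)%N ->
  dvd3 k (u n.+1 - v n.+1) -> dvd3 k (u n - v n).
Proof.
elim: k n => [|k IH] [|n] // kn h; [exact: dvd3_0l|exact: dvd3_0l|].
have h1 := IH _ (ltnW kn) (dvd3W (leqnSn k) h).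
have h0 := IH _ kn h1.
have -> : u n.+1 - v n.+1 = (u n.+2 - v n.+2)
    + 3 * ((1 + u n.+1 + v n.+1) * (u n.+1 - v n.+1) - (u n - v n)).
  by rewrite uP vP; ring.
by apply: dvd3D h (dvd3S (dvd3B (dvd3Ml _ h1) h0)).
Qed.

End two_henon_seqs.

(** The limit is diagonal: its k-th residue is taken from the k-th approximation. *)
Lemma Z3_complete (x : nat -> Z3) :
  (forall k, dvd3 k (x k.+1 - x k)) -> exists y, forall k, dvd3 k (y - x k).
Proof.
move=> xP; have yP : coherent (fun k => x k k).
  move=> k; rewrite res3P; have [c ->] := dvd3_subE (xP k).
  have /dvd3_res ck : dvd3 k (3 ^+ k * c) by exists c.
  by rewrite res3D ck addr0 !res3_mod.
exists (MkZ3 yP) => k; apply/dvd3_res.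
by rewrite res3D res3N modzDmr subrr mod0z.
Qed.

(** * The ultrametric on Q_3^2 *)

Section ultrametric.
Variable R : realType.
Implicit Types (p q : Q3 R) (z : Q3sq R).

(** The exponent is k + 1 because points of B_{1/3}(1,1) have coordinates 1 + 3 u: level k then
    means congruence of the u modulo 3^k. *)
Definition near3 (k : nat) (z z' : Q3sq R) : Prop := norm3 (z - z') <= 3 ^- k.+1.

Lemma abs3_1 : abs3 (1 : Q3 R) = 1.
Proof. by rewrite -tofrac1 abs3_tofrac absZ3_1. Qed.

Lemma Q3_3_neq0 : (3 : Q3 R) != 0.
Proof. by rewrite -abs3_eq0 abs3_3 invr_eq0 pnatr_eq0. Qed.

Lemma abs3_3V : abs3 (3^-1 : Q3 R) = 3.
Proof.
apply: (mulfI (x := 3^-1)); first by rewrite invr_eq0.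
by rewrite -{1}(abs3_3 R) -abs3M mulfV ?Q3_3_neq0 // abs3_1 mulVf.
Qed.

Lemma abs3D_le p q (r : R) : abs3 p <= r -> abs3 q <= r -> abs3 (p + q) <= r.
Proof. by move=> pr qr; apply: le_trans (abs3D _ _) _; rewrite ge_max pr qr. Qed.

Lemma abs3_dominant p q : abs3 q < abs3 p -> abs3 p <= abs3 (p + q).
Proof.
move=> qp; have := abs3D (p + q) (- q); rewrite addrK abs3N le_max => /orP[//|].
by rewrite leNgt qp.
Qed.

Lemma norm3_le z (r : R) : (norm3 z <= r) = (abs3 z.1 <= r) && (abs3 z.2 <= r).
Proof. by rewrite /norm3 ge_max. Qed.

Lemma norm3D_le z z' (r : R) : norm3 z <= r -> norm3 z' <= r -> norm3 (z + z') <= r.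
Proof. by rewrite !norm3_le => /andP[? ?] /andP[? ?]; rewrite !abs3D_le. Qed.

Lemma norm3N z : norm3 (- z) = norm3 z.
Proof. by rewrite /norm3 /= !abs3N. Qed.

Lemma near3_refl k z : near3 k z z.
Proof. by rewrite /near3 subrr norm3_le /= abs3_0 invr_ge0 exprn_ge0. Qed.

Lemma near3_sym k z z' : near3 k z z' -> near3 k z' z.
Proof. by rewrite /near3 -norm3N opprB. Qed.

Lemma near3_trans k z' z z'' : near3 k z z' -> near3 k z' z'' -> near3 k z z''.
Proof.
by move=> zz' z'z; rewrite /near3 -(subrKA z'); exact: norm3D_le zz' z'z.
Qed.

Lemma near3W k m z z' : (m <= k)%N -> near3 k z z' -> near3 m z z'.
Proof.
move=> mk /le_trans; apply.
by rewrite lef_pV2 ?posrE ?exprn_gt0 // ler_eXn2l ?ltr1n.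
Qed.

Lemma exp3V_lt (e : R) : 0 < e -> exists k, 3 ^- k.+1 < e.
Proof.
move=> e0; have [k] := ltr_add_invr e0; rewrite add0r => ke.
exists k; apply: le_lt_trans ke.
by rewrite lef_pV2 ?posrE ?exprn_gt0 ?ltr0n // -natrX ler_nat ltnW // ltn_expl.
Qed.

Lemma near3_eq z z' : (forall k, near3 k z z') -> z = z'.
Proof.
move=> zz'; apply: mdist_positivity; apply/eqP; rewrite eq_le mdist_ge0 andbT.
apply/ler_addgt0Pr => e e0; rewrite add0r mdist_norm3.
by have [k ke] := exp3V_lt e0; apply: le_trans (zz' k) (ltW ke).
Qed.

Lemma cball_near3 k z z' : cball z (3 ^- k.+1) z' <-> near3 k z' z.
Proof. by []. Qed.

Lemma cball_eqP k z z' :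
  cball z (3 ^- k.+1) = cball z' (3 ^- k.+1) <-> near3 k z z'.
Proof.
split=> [E|zz'].
  by have : cball z (3 ^- k.+1) z; [exact: near3_refl|rewrite E].
apply/seteqP; split=> t /cball_near3 tz; apply/cball_near3.
  exact: near3_trans tz zz'.
exact: near3_trans tz (near3_sym zz').
Qed.

End ultrametric.

(** * The Henon map on Z_3^2 *)

Section henon_Z3.
Variables (R : realType) (al : Z3).
Local Notation "x %:Q3" := (FracField.tofrac x : Q3 R) (at level 2, format "x %:Q3").
Local Notation a := (2 + 9 * al)%:Q3.
Local Notation phi := (henon a 3).
Local Notation psi := (henon_inv a 3).
Local Notation B1 := (unit_ball R).
Local Notation B11 := (cball ((1, 1) : Q3sq R) 3^-1).
Implicit Types z : Q3sq R.

Definition Z3pair (x y : Z3) : Q3sq R := (x%:Q3, y%:Q3).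

Lemma near3_pair k x y x' y' :
  near3 k (Z3pair x y) (Z3pair x' y') <-> dvd3 k.+1 (x - x') /\ dvd3 k.+1 (y - y').
Proof.
rewrite /near3 norm3_le /= -!tofracB !abs3_tofrac.
by split=> [/andP[/absZ3_le ? /absZ3_le ?]|[/(absZ3_le R) -> /(absZ3_le R) ->]].
Qed.

Lemma unit_ballP z : B1 z <-> exists x y, z = Z3pair x y.
Proof.
rewrite /unit_ball /cball /= norm3_le /= !subr0; split.
  case: z => p q /= /andP[/abs3_le1[x ->] /abs3_le1[y ->]].
  by exists x, y.
have le1 x : abs3 x%:Q3 <= 1.
  by rewrite abs3_tofrac; have /(absZ3_le R 0) := dvd3_0l x; rewrite invr1.
by move=> [x [y ->]]; rewrite !le1.
Qed.

Lemma B11_near3 z : B11 z <-> near3 0 z (Z3pair 1 1).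
Proof. by rewrite /near3 /Z3pair tofrac1 expr1. Qed.

Lemma B11P z : B11 z <-> exists u v, z = Z3pair (1 + 3 * u) (1 + 3 * v).
Proof.
rewrite B11_near3; split=> [z1|[u [v ->]]].
  have : B1 z.
    rewrite /unit_ball /cball /= (_ : z - _ = (z - Z3pair 1 1) + Z3pair 1 1); last first.
      by rewrite subrK subr0.
    apply: norm3D_le; last by rewrite norm3_le /= tofrac1 abs3_1 lexx.
    by apply: le_trans z1 _; rewrite invf_le1 ?exprn_gt0 // expr1 ler1n.
  move=> /unit_ballP[x [y E]]; move: z1; rewrite E => /near3_pair[].
  move=> /dvd3_subE[u ->] /dvd3_subE[v ->]; exists u, v.
  by rewrite expr1.
by apply/near3_pair; split; [exists u|exists v]; rewrite expr1 addrC addKr.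
Qed.

Lemma B11_sub_B1 : B11 `<=` B1.
Proof. by move=> z /B11P[u [v ->]]; apply/unit_ballP; do 2!eexists. Qed.

Lemma henon_pair x y :
  phi (Z3pair x y) = Z3pair (2 + 9 * al + 3 * y - x ^+ 2) x.
Proof.
rewrite /henon /Z3pair /=; congr pair.
move: (2 + 9 * al) => c; rewrite tofracB tofracD tofracM tofracXn.
by have -> : (3 : Z3)%:Q3 = 3 by rewrite rmorph_nat.
Qed.

Lemma henon_B1 z : B1 z -> B1 (phi z).
Proof.
by move=> /unit_ballP[x [y ->]]; apply/unit_ballP; rewrite henon_pair; do 2!eexists.
Qed.

Lemma iter_henon_B1 n z : B1 z -> B1 (iter n phi z).
Proof. by move=> z1; elim: n => //= n; exact: henon_B1. Qed.

Lemma henon_B11_pair u v :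
  phi (Z3pair (1 + 3 * u) (1 + 3 * v)) =
  Z3pair (1 + 3 * (1 + 3 * al - 2 * u + 3 * v - 3 * u ^+ 2)) (1 + 3 * u).
Proof. by rewrite henon_pair; congr Z3pair; ring. Qed.

Lemma henon_B11 z : B11 z -> B11 (phi z).
Proof.
by move=> /B11P[u [v ->]]; apply/B11P; rewrite henon_B11_pair; do 2!eexists.
Qed.

(* Modulo 3 the map on the first coordinate is 0 -> 2 -> 1 -> 1. *)
Lemma iter3_henon_B11 z : B1 z -> B11 (iter 3 phi z).
Proof.
move=> /unit_ballP[x [y ->]] /=; rewrite !henon_pair.
have step (s t : Z3) : dvd3 1 (s - 1) -> dvd3 1 (2 + 9 * al + 3 * t - s ^+ 2 - 1).
  move=> /dvd3_subE[c ->]; exists (3 * al + t - 2 * c - 3 * c ^+ 2); ring.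
(* Two iterations bring the first coordinate to 1 modulo 3, and the third one copies it to the
   second coordinate. *)
suff X2 : dvd3 1 (2 + 9 * al + 3 * x - (2 + 9 * al + 3 * y - x ^+ 2) ^+ 2 - 1).
  by apply/B11_near3/near3_pair; split=> //; exact: step.
have [c [i + ->]] := modn3P x; case: i => [|[|[|i]]] // _.
- exists (- 1 + 3 * al + 3 * c - 4 * (3 * al + y - 3 * c ^+ 2)
          - 3 * (3 * al + y - 3 * c ^+ 2) ^+ 2); ring.
- by apply/step/step; exists c; ring.
- apply: step; exists (3 * al + y - 3 * c ^+ 2 - 4 * c - 1); ring.
Qed.

Lemma henon_near3 k z z' : B1 z -> B1 z' -> near3 k z z' -> near3 k (phi z) (phi z').
Proof.
move=> /unit_ballP[x [y ->]] /unit_ballP[x' [y' ->]]; rewrite !henon_pair.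
move=> /near3_pair[xx yy]; apply/near3_pair; split=> //.
rewrite (_ : _ - _ = 3 * (y - y') + (- x - x') * (x - x')); last by ring.
by apply: dvd3D; exact: dvd3Ml.
Qed.

Lemma iter_henon_near3 k n z z' : B1 z -> B1 z' ->
  near3 k z z' -> near3 k (iter n phi z) (iter n phi z').
Proof.
move=> z1 z1' zz'; elim: n => //= n.
by apply: henon_near3; exact: iter_henon_B1.
Qed.

(** One level is lost because [psi] divides by 3. *)
Lemma henon_inv_near3 k z z' : B1 z -> B1 z' ->
  near3 k.+1 z z' -> near3 k (psi z) (psi z').
Proof.
rewrite /unit_ball /cball /near3 /henon_inv /= !norm3_le /= !subr0.
move=> /andP[_ y1] /andP[_ y1'] /andP[xx yy].
have le_pow : 3 ^- k.+2 <= 3 ^- k.+1 :> R.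
  by rewrite lef_pV2 ?posrE ?exprn_gt0 // ler_eXn2l ?ltr1n.
rewrite (le_trans yy le_pow) /= -mulrBr.
have -> : z.1 - a + z.2 ^+ 2 - (z'.1 - a + z'.2 ^+ 2)
  = (z.1 - z'.1) + (z.2 + z'.2) * (z.2 - z'.2) by ring.
rewrite abs3M abs3_3V -ler_pdivlMl // -invfM -exprS.
apply: abs3D_le => //; rewrite abs3M -[leRHS]mul1r.
by rewrite ler_pM ?abs3_ge0 // abs3D_le.
Qed.

Lemma henon_orbit u v : exists U, [/\ henon_seq al U, U 0%N = v, U 1%N = u &
  forall n, iter n phi (Z3pair (1 + 3 * u) (1 + 3 * v)) =
            Z3pair (1 + 3 * U n.+1) (1 + 3 * U n)].
Proof.
pose f (p : Z3 * Z3) := (1 + 3 * al - 2 * p.1 + 3 * p.2 - 3 * p.1 ^+ 2, p.1).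
pose U n := (iter n f (u, v)).2.
exists U; split=> //; elim=> //= n ->.
by rewrite henon_B11_pair.
Qed.

Lemma near3_B11_pair k x y x' y' :
  near3 k (Z3pair (1 + 3 * x) (1 + 3 * y)) (Z3pair (1 + 3 * x') (1 + 3 * y'))
  <-> dvd3 k (x - x') /\ dvd3 k (y - y').
Proof.
have E (s t : Z3) : dvd3 k.+1 ((1 + 3 * s) - (1 + 3 * t)) <-> dvd3 k (s - t).
  rewrite (_ : _ - _ = 3 * (s - t)); last by ring.
  by split=> [|/dvd3S//]; rewrite -add1n -{1}(expr1 (3 : Z3)) => /dvd3_cancel.
by split=> [/near3_pair|] [/E ? /E ?] //; apply/near3_pair.
Qed.

End henon_Z3.

(** * The bounded two-sided orbits *)

Section henon_attractor.
Variables (R : realType) (al : Z3).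
Local Notation "x %:Q3" := (FracField.tofrac x : Q3 R) (at level 2, format "x %:Q3").
Local Notation a := (2 + 9 * al)%:Q3.
Local Notation phi := (henon a 3).
Local Notation psi := (henon_inv a 3).
Local Notation B1 := (unit_ball R).
Local Notation B11 := (cball ((1, 1) : Q3sq R) 3^-1).
Local Notation J := (henonJ a 3).
Implicit Types z : Q3sq R.

Definition base_orbit n : Q3sq R := iter n phi (1, 1).
Local Notation w := base_orbit.

Lemma iter_base_orbit n m : iter n phi (w m) = w (n + m)%N.
Proof. by rewrite /w iterD. Qed.

Lemma base_orbit_pair : exists u, [/\ henon_seq al u &
  forall n, w n = Z3pair R (1 + 3 * u n.+1) (1 + 3 * u n)].
Proof.
have [u [uP _ _ uE]] := henon_orbit R al 0 0.
exists u; split=> // n; rewrite -uE /w; congr iter.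
by rewrite /Z3pair mulr0 addr0 tofrac1.
Qed.

Lemma base_orbit_B11 n : B11 (w n).
Proof.
by have [u [_ E]] := base_orbit_pair; apply/B11P; rewrite E; do 2!eexists.
Qed.

Lemma base_orbit_B1 n : B1 (w n).
Proof. exact/B11_sub_B1/base_orbit_B11. Qed.

Lemma abs3_le_dvd3 k x y :
  abs3 ((1 + 3 * x)%:Q3 - (1 + 3 * y)%:Q3) <= 3 ^- k.+1 -> dvd3 k (x - y).
Proof.
rewrite -tofracB abs3_tofrac (_ : _ - _ = 3 ^+ 1 * (x - y)); last by ring.
by move=> /absZ3_le; rewrite -add1n => /dvd3_cancel.
Qed.

(** Only first coordinates are compared; this is what makes J a graph over the first coordinate in
    [henonJ_fst]. *)
Lemma base_orbit_mod k n m : (k.*2.+1 <= n)%N -> (k.*2.+1 <= m)%N ->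
  abs3 ((w n).1 - (w m).1) <= 3 ^- k.+1 -> (n = m %[mod 3 ^ k])%N.
Proof.
move=> nk mk; have [u [uP E]] := base_orbit_pair; rewrite !E => /abs3_le_dvd3.
wlog mn : n m nk mk / (m <= n)%N => [wl h|].
  have [/wl|/ltnW/wl] := leqP m n; first exact.
  by move/(_ mk nk (dvd3C h)).
rewrite -{1}(subnKC mn) -addSn => /(henon_seq_injective uP (leqW mk)) h.
by apply/eqP; rewrite eqn_mod_dvd.
Qed.

Lemma base_orbit_near3 k n m : (k.*2.+1 <= n)%N -> (k.*2.+1 <= m)%N ->
  (n = m %[mod 3 ^ k])%N -> near3 k (w n) (w m).
Proof.
move=> nk mk nm; wlog mn : n m nk mk nm / (m <= n)%N => [wl|].
  by have [/wl|/ltnW/wl h] := leqP m n; [exact | exact/near3_sym/h].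
have [u [uP E]] := base_orbit_pair; rewrite !E; apply/near3_B11_pair.
have /dvdnP[q nq] : (3 ^ k %| n - m)%N by rewrite -eqn_mod_dvd //; exact/eqP.
rewrite -(subnKC mn) nq mulnC -addSn.
by split; apply: henon_seq_periodic => //; exact: leqW.
Qed.

Lemma base_orbit_near3P k n m : (k.*2.+1 <= n)%N -> (k.*2.+1 <= m)%N ->
  near3 k (w n) (w m) <-> (n = m %[mod 3 ^ k])%N.
Proof.
move=> nk mk; split; last exact: base_orbit_near3.
by rewrite /near3 norm3_le => /andP[+ _]; exact: base_orbit_mod.
Qed.

(** Surjectivity onto the residues matches the first coordinates. The second coordinates are the
    preceding terms and follow by [henon_seq_dvdB], which is why [k <= n] is required. *)
Lemma orbit_catch k n m z : B11 z -> (k <= n)%N -> (k.*2.+1 <= m)%N ->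
  exists2 j, (m <= j < m + 3 ^ k)%N & near3 k (iter n phi z) (w j).
Proof.
move=> /B11P[x [y ->]] kn mk.
have [v [vP _ _ ->]] := henon_orbit R al x y.
have [u [uP uE]] := base_orbit_pair.
have [[|j] // jm h] := henon_seq_surjective uP (v n.+1) (leqW mk).
exists j => //; rewrite uE; apply/near3_B11_pair; split=> //.
have kj : (k <= j)%N by move: jm => /andP[]; lia.
(* The two orbits are compared at different times n and j; both are shifted to index k, the least
   that [henon_seq_dvdB] allows at level k. *)
have := henon_seq_dvdB (henon_seq_shift (n - k) vP) (henon_seq_shift (j - k) uP) (leqnn k).
by rewrite !addSn !subnKC //; exact.
Qed.

Lemma henonJ_norm z : J z <-> exists M, forall n,
  norm3 (iter n phi z) <= M /\ norm3 (iter n psi z) <= M.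
Proof.
split=> -[M zM]; exists M.
  by case=> [|n]; [have := zM 0 | have := zM (Negz n); have := zM n.+1].
by case=> n /=; [have [] := zM n | have [] := zM n.+1].
Qed.

Lemma henonKQ : cancel phi psi. Proof. exact/henonK/Q3_3_neq0. Qed.
Lemma henon_invKQ : cancel psi phi. Proof. exact/henon_invK/Q3_3_neq0. Qed.

Lemma henonJ_fwd z : J z -> J (phi z).
Proof.
move=> /henonJ_norm[M zM]; apply/henonJ_norm; exists M => n.
split; first by rewrite -iterSr; have [] := zM n.+1.
case: n => [|n]; first by have [] := zM 1%N.
by rewrite iterSr henonKQ; have [] := zM n.
Qed.

Lemma henonJ_bwd z : J z -> J (psi z).
Proof.
move=> /henonJ_norm[M zM]; apply/henonJ_norm; exists M => n.
split; last by rewrite -iterSr; have [] := zM n.+1.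
case: n => [|n]; first by have [] := zM 1%N.
by rewrite iterSr henon_invKQ; have [] := zM n.
Qed.

Lemma iter_henon_inv n z : iter n phi (iter n psi z) = z.
Proof. by elim: n z => // n IH z; rewrite iterSr iterS henon_invKQ IH. Qed.

(** The linear lower bound 1 + (n + 1) d survives squaring and already exceeds every [M]. *)
Lemma unbounded_growth (t : nat -> R) M :
  1 < t 0%N -> (forall n, 0 <= t n -> t n ^+ 2 <= t n.+1) -> exists n, M < t n.
Proof.
move=> t0 tS; set d := t 0%N - 1; have d0 : 0 < d by rewrite subr_gt0.
have growth n : 1 + n.+1%:R * d <= t n.
  elim: n => [|n IH]; first by rewrite mul1r /d addrC subrK.
  have nd : 0 <= n%:R * d by rewrite mulr_ge0 ?ler0n ?ltW.
  have /tS : 0 <= t n by move: IH; rewrite -natr1; lra.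
  apply: le_trans; move: IH nd; rewrite -!natr1; set s := n%:R * d.
  have -> : (n%:R + 1) * d = s + d by rewrite mulrDl mul1r.
  have -> : (n%:R + 1 + 1) * d = s + d + d by rewrite !mulrDl !mul1r.
  by move=> IH nd; nra.
have M1 : 0 < `|M| + 1 by rewrite ltr_wpDl.
have [|n] := @ltr_add_invr R 0 (d / (`|M| + 1)); first by rewrite divr_gt0.
rewrite add0r ltr_pdivlMr // mulrC ltr_pdivrMr ?ltr0n // => h.
exists n; apply: lt_le_trans (growth n).
by have := ler_norm M; rewrite mulrC; lra.
Qed.

(** Outside the unit ball the larger coordinate decides. If it is the first, x^2 dominates in [phi]
    and |x| is at least squared at each forward step; if it is the second, y^2 / 3 dominates in
    [psi] and |y| is at least squared at each backward step. *)
Lemma henonJ_B1 : J `<=` B1.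
Proof.
move=> z Jz; rewrite /unit_ball /cball /= subr0; apply: contrapT => /negP.
rewrite -ltNge => z1.
have a1 : abs3 a <= 1.
  have /unit_ballP : exists x y, ((a, 0) : Q3sq R) = Z3pair R x y.
    by exists (2 + 9 * al), 0; rewrite /Z3pair tofrac0.
  by rewrite /unit_ball /cball /= norm3_le /= !subr0 => /andP[].
have /henonJ_norm[M zM] := Jz.
case: (leP (abs3 z.2) (abs3 z.1)) => z12.
- have x1 : 1 < abs3 z.1 by move: z1; rewrite /norm3 (max_idPl z12).
  pose t n := abs3 (iter n phi z).1.
  have tS n : 1 < t n -> abs3 (iter n phi z).2 <= t n -> t n ^+ 2 <= t n.+1.
    rewrite /t /=; move: (iter n phi z) => [x y] /= {}x1 yx.
    rewrite expr2 -abs3M -expr2 -(abs3N (x ^+ 2)) addrC; apply: abs3_dominant.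
    rewrite abs3N expr2 abs3M.
    apply: le_lt_trans (_ : abs3 x < _); last by rewrite ltr_pMl // (lt_trans ltr01).
    apply: abs3D_le; first exact: le_trans a1 (ltW x1).
    rewrite abs3M abs3_3; apply: le_trans yx; apply: ler_piMl; first exact: abs3_ge0.
    by rewrite invf_le1 // ler1n.
  have tP n : 1 < t n /\ abs3 (iter n phi z).2 <= t n.
    elim: n => // n [tn yn]; have tn1 := tS n tn yn.
    have tt : t n <= t n.+1.
      by apply: le_trans tn1; rewrite expr2 ler_peMl // ltW // (lt_trans ltr01).
    by split=> //; exact: lt_le_trans tt.
  have [n] := @unbounded_growth t M x1 (fun n _ => tS n (tP n).1 (tP n).2).
  rewrite ltNge => /negP; apply; have [] := zM n.
  by rewrite norm3_le => /andP[].
- have y1 : 1 < abs3 z.2 by move: z1; rewrite /norm3 (max_idPr (ltW z12)).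
  pose t n := abs3 (iter n psi z).2.
  have tS n : 1 < t n -> abs3 (iter n psi z).1 <= t n -> t n ^+ 2 <= t n.+1.
    rewrite /t /=; move: (iter n psi z) => [x y] /= {}y1 xy.
    rewrite abs3M abs3_3V expr2 -abs3M -expr2 addrC.
    have h : abs3 (y ^+ 2) <= abs3 (y ^+ 2 + (x - a)).
      apply: abs3_dominant; rewrite expr2 abs3M.
      apply: le_lt_trans (_ : abs3 y < _); last by rewrite ltr_pMl // (lt_trans ltr01).
      by apply: abs3D_le => //; rewrite abs3N; exact: le_trans a1 (ltW y1).
    by apply: (le_trans h); rewrite ler_peMl ?abs3_ge0 // ler1n.
  have tP n : 1 < t n /\ abs3 (iter n psi z).1 <= t n.
    elim: n => [|n [tn yn]]; first by split=> //; exact: ltW.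
    have tn1 := tS n tn yn.
    have tt : t n <= t n.+1.
      by apply: le_trans tn1; rewrite expr2 ler_peMl // ltW // (lt_trans ltr01).
    by split=> //; exact: lt_le_trans tt.
  have [n] := @unbounded_growth t M y1 (fun n _ => tS n (tP n).1 (tP n).2).
  rewrite ltNge => /negP; apply; have [] := zM n => _.
  by rewrite norm3_le => /andP[].
Qed.

Lemma iter_henonJ_inv n z : J z -> J (iter n psi z).
Proof. by move=> zJ; elim: n => //= n; exact: henonJ_bwd. Qed.

(** By invariance every point of J is a third iterate of a point of J. *)
Lemma henonJ_B11 : J `<=` B11.
Proof.
move=> z zJ; rewrite -(iter_henon_inv 3 z).
exact/iter3_henon_B11/henonJ_B1/iter_henonJ_inv.
Qed.

Lemma henonJ_near3 k m z : J z -> (k.*2.+1 <= m)%N ->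
  exists2 j, (m <= j < m + 3 ^ k)%N & near3 k z (w j).
Proof.
move=> zJ mk; rewrite -(iter_henon_inv k z).
by apply: orbit_catch => //; exact/henonJ_B11/iter_henonJ_inv.
Qed.

(** The omega-limit set of w. One index per level is enough, as the other indices in its class
    modulo 3^k supply arbitrarily late ones. *)
Definition omega_base z : Prop :=
  forall k, exists2 m, (k.*2.+1 <= m)%N & near3 k z (w m).

Lemma omega_base_B1 z : omega_base z -> B1 z.
Proof.
move=> /(_ 0%N)[m _ zm]; apply/B11_sub_B1/B11_near3; apply: (near3_trans zm).
exact/B11_near3/base_orbit_B11.
Qed.

Lemma omega_base_fwd z : omega_base z -> omega_base (phi z).
Proof.
move=> zP k; have [m mk zm] := zP k; exists m.+1; first exact: leqW.
by apply: henon_near3 => //; [exact: omega_base_B1|exact: base_orbit_B1].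
Qed.

Lemma omega_base_bwd z : omega_base z -> omega_base (psi z).
Proof.
move=> zP k; have [[|m] // mk zm] := zP k.+1; exists m; first by lia.
rewrite -[w m]henonKQ; apply: henon_inv_near3 zm; first exact: omega_base_B1.
exact: base_orbit_B1.
Qed.

Lemma omega_base_henonJ z : omega_base z -> J z.
Proof.
move=> zP; apply/henonJ_norm; exists 1 => n.
have B1_le t : omega_base t -> norm3 t <= 1.
  by move=> /omega_base_B1; rewrite /unit_ball /cball /= subr0.
split; apply: B1_le; elim: n => //= n.
  exact: omega_base_fwd.
exact: omega_base_bwd.
Qed.

Lemma henonJP z : J z <-> omega_base z.
Proof.
split=> [zJ k|]; last exact: omega_base_henonJ.
by have [m /andP[? _] ?] := henonJ_near3 zJ (leqnn k.*2.+1); exists m.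
Qed.

(** The odometer coding: a coherent sequence of indices, that is an element of Z_3, determines a
    point of J. *)
Lemma henonJ_lim (i : nat -> nat) :
  (forall k, (k.*2.+1 <= i k)%N) -> (forall k, i k.+1 = i k %[mod 3 ^ k])%N ->
  exists z, J z /\ forall k, near3 k z (w (i k)).
Proof.
move=> iP iS; have [u [uP E]] := base_orbit_pair.
have near k : near3 k (w (i k.+1)) (w (i k)).
  by apply: base_orbit_near3 => //; apply: leq_trans (iP k.+1); lia.
have [x xP] : exists x, forall k, dvd3 k (x - u (i k).+1).
  by apply: Z3_complete => k; have := near k; rewrite !E => /near3_B11_pair[].
have [y yP] : exists y, forall k, dvd3 k (y - u (i k)).
  by apply: Z3_complete => k; have := near k; rewrite !E => /near3_B11_pair[].
have zP k : near3 k (Z3pair R (1 + 3 * x) (1 + 3 * y)) (w (i k)).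
  by rewrite E; apply/near3_B11_pair.
exists (Z3pair R (1 + 3 * x) (1 + 3 * y)); split=> //.
by apply/henonJP => k; exists (i k).
Qed.

Lemma henonJ_near_base k m : (k.*2.+1 <= m)%N ->
  exists z, J z /\ near3 k z (w m).
Proof.
(* The multiple of 3^j pushes the index beyond 2j + 1 without changing it modulo 3^j. *)
move=> mk; have [z [zJ zP]] : exists z, J z /\ forall j, near3 j z (w (m + j.*2.+1 * 3 ^ j)).
  apply: henonJ_lim => j.
    by apply: leq_trans (leq_addl _ _); rewrite leq_pmulr // expn_gt0.
  by rewrite expnS mulnA !(addnC m) !modnMDl.
exists z; split=> //; apply: (near3_trans (zP k)).
by apply: base_orbit_near3 => //; [lia|rewrite addnC modnMDl].
Qed.

Lemma henonJ_fst z z' : J z -> J z' -> z.1 = z'.1 -> z = z'.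
Proof.
move=> zJ z'J E; apply: near3_eq => k.
have [m /andP[mk _] zm] := henonJ_near3 zJ (leqnn k.*2.+1).
have [n /andP[nk _] zn] := henonJ_near3 z'J (leqnn k.*2.+1).
apply: (near3_trans zm); apply: near3_trans (near3_sym zn).
apply: base_orbit_near3 => //; apply: base_orbit_mod => //.
move: zm zn; rewrite /near3 !norm3_le /= => /andP[zm _] /andP[zn _].
rewrite -(subrKA z.1); apply: abs3D_le; last by rewrite E.
by rewrite -abs3N opprB.
Qed.

Lemma iter_near_base k n z m : B1 z -> near3 k z (w m) ->
  near3 k (iter n phi z) (w (n + m)).
Proof.
move=> z1 zm; rewrite -iter_base_orbit.
by apply: iter_henon_near3 => //; exact: base_orbit_B1.
Qed.

(** A period n would be divisible by every power of 3; level n already contradicts this, since n <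
    3^n. *)
Lemma henonJ_aperiodic z n : J z -> (0 < n)%N -> iter n phi z <> z.
Proof.
move=> zJ n0 nz; have nk : (n < 3 ^ n)%N by rewrite ltn_expl.
have [m /andP[mk _] zm] := henonJ_near3 zJ (leqnn n.*2.+1).
have := iter_near_base n (henonJ_B1 zJ) zm; rewrite nz => h.
have /base_orbit_near3P : near3 n (w (n + m)) (w m) := near3_trans (near3_sym h) zm.
move=> /(_ (leq_trans mk (leq_addl _ _)) mk) /eqP.
by rewrite -{2}(add0n m) eqn_modDr mod0n modn_small // eqn0Ngt n0.
Qed.

Lemma henonJ_dense_near z z' k : J z -> J z' -> exists n, near3 k (iter n phi z) z'.
Proof.
move=> zJ z'J; have [m /andP[mk _] zm] := henonJ_near3 zJ (leqnn k.*2.+1).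
have [n /andP[mn _] zn] := henonJ_near3 z'J mk.
exists (n - m)%N; apply: near3_trans (near3_sym zn).
by have := iter_near_base (n - m) (henonJ_B1 zJ) zm; rewrite subnK.
Qed.

End henon_attractor.

(** * Topology of Q_3^2 and compactness of the unit ball *)

Lemma ultra_pigeonhole (T : Type) (F : set_system T) (g : T -> nat) n :
  UltraFilter F -> F [set t | (g t < n)%N] -> exists i, F [set t | g t = i].
Proof.
move=> FU; elim: n => [|n IH] Fn.
  by have [t] := filter_ex Fn.
have [Fg|Fg] := in_ultra_setVsetC [set t | g t = n] FU; first by exists n.
apply: IH; apply: filterS (filterI Fn Fg) => t /= [+ gn].
by rewrite ltnS leq_eqVlt => /orP[/eqP|].
Qed.

Section topology.
Variable R : realType.
Implicit Types z : Q3sq R.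
Local Notation B1 := (unit_ball R).

Lemma nbhs_near3P z (A : set (Q3sq R)) :
  nbhs z A <-> exists k, forall z', near3 k z z' -> A z'.
Proof.
split=> [/nbhs_ballP[e /= e0 eA]|[k kA]].
  have [k ke] := exp3V_lt e0; exists k => z' zz'; apply: eA.
  by rewrite ballEmdist /= mdist_norm3; exact: le_lt_trans zz' ke.
apply/nbhs_ballP; exists (3 ^- k.+1); first by rewrite /= invr_gt0 exprn_gt0.
by move=> z'; rewrite ballEmdist /= mdist_norm3 => /ltW; exact: kA.
Qed.

Lemma open_near3 k z : open [set z' | near3 k z' z].
Proof.
rewrite openE => z' zz'; apply/nbhs_near3P; exists k => t.
by move=> /near3_sym tz; exact: near3_trans tz zz'.
Qed.

Lemma open_unit_ball : open B1.
Proof.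
rewrite openE => z z1; apply/nbhs_near3P; exists 0%N => z' zz'.
rewrite /unit_ball /cball /= (_ : z' - _ = (z' - z) + (z - (0, 0))); last first.
  by rewrite subrKA.
apply: norm3D_le z1; apply: le_trans (near3_sym zz') _.
by rewrite expr1 invf_le1 // ler1n.
Qed.

(** At each level an ultrafilter on the ball selects one pair of residues by the pigeonhole
    principle. The selections are coherent, and the point they define is a limit of the
    ultrafilter. *)
Lemma compact_unit_ball : compact B1.
Proof.
rewrite compact_ultra => F FU FB.
(* Integral coordinates as a total function, with junk value outside the ball. *)
have skolem z : exists q, B1 z -> z = Z3pair R q.1 q.2.
  have [/unit_ballP[x [y E]]|] := pselect (B1 z); first by exists (x, y).
  by exists (0, 0).
have [p pP] := choice skolem.
have res k : exists c : Z3 * Z3, F [set z | near3 k z (Z3pair R c.1 c.2)].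
  have Fx : F [set z | (`|(p z).1 k.+1| < 3 ^ k.+1)%N].
    by apply: filterS FB => z _; exact: absz_res_lt.
  have Fy : F [set z | (`|(p z).2 k.+1| < 3 ^ k.+1)%N].
    by apply: filterS FB => z _; exact: absz_res_lt.
  have [i Fi] := ultra_pigeonhole FU Fx; have [j Fj] := ultra_pigeonhole FU Fy.
  have Fij : F (B1 `&` ([set t | `|(p t).1 k.+1|%N = i] `&` [set t | `|(p t).2 k.+1|%N = j])).
    by apply: filterI => //; exact: filterI.
  have [t /= [t1 [ti tj]]] := filter_ex Fij.
  exists (p t); apply: filterS Fij => z /= [z1 [zi zj]].
  rewrite (pP z z1); apply/near3_pair.
  by split; apply: absz_res_eq; rewrite ?zi ?zj.
have [c cF] := choice res.
have cS k : near3 k (Z3pair R (c k.+1).1 (c k.+1).2) (Z3pair R (c k).1 (c k).2).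
  have [z [/= zk zk1]] := filter_ex (filterI (cF k) (cF k.+1)).
  by apply: near3_trans zk; apply/near3_sym/(near3W (leqnSn k)).
have [x xP] : exists x, forall k, dvd3 k (x - (c k).1).
  apply: Z3_complete => k; have /near3_pair[h _] := cS k.
  exact: dvd3W (leqnSn k) h.
have [y yP] : exists y, forall k, dvd3 k (y - (c k).2).
  apply: Z3_complete => k; have /near3_pair[_ h] := cS k.
  exact: dvd3W (leqnSn k) h.
exists (Z3pair R x y); split; first by apply/unit_ballP; exists x, y.
move=> A /nbhs_near3P[k kA]; apply: filterS (cF k.+1) => z zc; apply: kA.
apply: near3_trans (near3_sym (near3W (leqnSn k) zc)).
by apply/near3_pair.
Qed.

End topology.

(** * J is an indecomposable attractor *)

Section henon_attractor_topology.
Variables (R : realType) (al : Z3).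
Local Notation "x %:Q3" := (FracField.tofrac x : Q3 R) (at level 2, format "x %:Q3").
Local Notation a := (2 + 9 * al)%:Q3.
Local Notation phi := (henon a 3).
Local Notation psi := (henon_inv a 3).
Local Notation B1 := (unit_ball R).
Local Notation B11 := (cball ((1, 1) : Q3sq R) 3^-1).
Local Notation J := (henonJ a 3).
Local Notation w := (base_orbit R al).
Implicit Types z : Q3sq R.

Lemma henonJ_closed : closed J.
Proof.
move=> z zJ; apply/henonJP => k.
have [|z' [z'J zz']] := zJ [set z' | near3 k z' z].
  by apply/nbhs_near3P; exists k => z' /near3_sym.
have /henonJP/(_ k)[m mk z'm] := z'J; exists m => //.
exact: near3_trans (near3_sym zz') z'm.
Qed.

Lemma henonJ_compact : compact J.
Proof.
exact: subclosed_compact henonJ_closed (@compact_unit_ball R) (@henonJ_B1 R al).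
Qed.

Lemma henonJ_nonempty : J !=set0.
Proof. by have [z [zJ _]] := @henonJ_near_base R al 0 1 isT; exists z. Qed.

Lemma image_henonJ : phi @` J = J.
Proof.
apply/seteqP; split=> [_ [z zJ <-]|z zJ]; first exact: henonJ_fwd.
by exists (psi z); [exact: henonJ_bwd | exact: henon_invKQ].
Qed.

Lemma B1_catch k n m z : B1 z -> (k + 3 <= n)%N -> (k.*2.+1 <= m)%N ->
  exists2 j, (m <= j < m + 3 ^ k)%N & near3 k (iter n phi z) (w j).
Proof.
move=> z1 kn mk; have -> : n = (n - 3 + 3)%N by lia.
by rewrite iterD; apply: orbit_catch => //; [exact: iter3_henon_B11 | lia].
Qed.

Lemma attractor_henonJ : attractor phi J.
Proof.
split; [exact: henonJ_nonempty|exact: henonJ_compact|exact: image_henonJ|].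
exists B1; split; first exact: open_unit_ball.
  split; first exact: henonJ_B1.
  (* The origin lies outside B_{1/3}(1,1), hence outside J. *)
  move=> /(_ (0, 0)); have B0 : B1 (0, 0).
    by rewrite /unit_ball /cball /= subrr norm3_le /= abs3_0 ler01.
  move=> /(_ B0) /henonJ_B11 /B11_near3; rewrite /near3 norm3_le /= => /andP[+ _].
  by rewrite sub0r abs3N tofrac1 abs3_1 expr1 leNgt invf_lt1 // ltr1n.
move=> z z1; apply/cvgrPdist_lt => e e0; have [k ke] := exp3V_lt e0.
exists (k + 3)%N => // n /= kn.
have [m /andP[mk _] nm] := B1_catch z1 kn (leqnn k.*2.+1).
have [t [tJ tm]] := henonJ_near_base R al mk.
have lb : lbound [set mdist (iter n phi z) y | y in J] 0.
  by move=> _ [y _ <-]; exact: mdist_ge0.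
have d0 : 0 <= dist_to J (iter n phi z).
  by apply: lb_le_inf lb; exists (mdist (iter n phi z) t), t.
rewrite sub0r normrN ger0_norm //; apply: le_lt_trans ke.
apply: (le_trans (y := mdist (iter n phi z) t)).
  by apply: ge_inf; [exists 0 | exists t].
by rewrite mdist_norm3; exact: near3_trans nm (near3_sym tm).
Qed.

Lemma henonJ_dense_orbit z : J z -> has_dense_forward_orbit_in phi J z.
Proof.
move=> zJ z' z'J A /nbhs_near3P[k kA].
have [n nz] := henonJ_dense_near k zJ z'J.
by exists (iter n phi z); split; [exists n | exact/kA/near3_sym].
Qed.

(** The orbit of a point of [A1] stays in the closed set [A1] and is dense in J, so [A1] is all of J
    and meets [A2]. *)
Lemma henonJ_indecomposable : indecomposable phi J.
Proof.
move=> [A1 [A2 [[[z1 z1A] A1c A1i _] [[z2 z2A] _ _ _] A12 JE]]].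
have A1cl : closed A1 := compact_closed (@metric_hausdorff _ _) A1c.
have z1J : J z1 by rewrite JE; left.
have z2J : J z2 by rewrite JE; right.
suff : (A1 `&` A2) z2 by rewrite A12.
split=> //; rewrite (closure_id A1).1 //.
apply: closure_subset (henonJ_dense_orbit z1J z2J) => _ [n _ <-].
by elim: n => //= n IH; rewrite -A1i; exists (iter n phi z1).
Qed.

End henon_attractor_topology.

(** * Periodic balls *)

Section periodic_balls.
Variables (R : realType) (al : Z3).
Local Notation "x %:Q3" := (FracField.tofrac x : Q3 R) (at level 2, format "x %:Q3").
Local Notation a := (2 + 9 * al)%:Q3.
Local Notation phi := (henon a 3).
Local Notation B1 := (unit_ball R).
Local Notation B11 := (cball ((1, 1) : Q3sq R) 3^-1).
Local Notation w := (base_orbit R al).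
Local Notation ball3 k c := (cball c (3 ^- k.+1)).
Implicit Types (z c : Q3sq R) (B : set (Q3sq R)).

Lemma near3_B1 k z c : B1 c -> near3 k z c -> B1 z.
Proof.
rewrite /unit_ball /cball /= !subr0 -{2}(subrK c z) => c1 zc; apply: norm3D_le => //.
by apply: le_trans zc _; rewrite invf_le1 ?exprn_gt0 // exprn_ege1 // ler1n.
Qed.

Lemma ball3_B1 k c : ball3 k c `<=` B1 <-> B1 c.
Proof.
split=> [|c1 z /cball_near3]; last exact: near3_B1.
by apply; exact: near3_refl.
Qed.

Lemma ball3_sub m k c c' : (m <= k)%N -> ball3 k c `<=` ball3 m c' <-> near3 m c c'.
Proof.
move=> mk; split=> [|cc' z zc]; first by apply; exact: near3_refl.
exact: near3_trans (near3W mk zc) cc'.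
Qed.

Lemma B11E : B11 = ball3 0 ((1, 1) : Q3sq R). Proof. by rewrite expr1. Qed.

Lemma image_ball_base k n m : (k.*2.+1 <= m)%N ->
  iter n phi @` ball3 k (w m) `<=` ball3 k (w (n + m)).
Proof.
move=> mk _ [z zm <-]; apply: iter_near_base => //.
exact: near3_B1 (base_orbit_B1 R al m) zm.
Qed.

(** A periodic ball returns to itself at arbitrarily late times, when all orbits are near w;
    conversely 3^k is a period of the balls around late points of w. *)
Lemma ball_periodicP k c : B1 c -> ball_periodic phi (ball3 k c) <->
  exists2 m, (k.*2.+1 <= m)%N & near3 k c (w m).
Proof.
move=> c1; split=> [[n n0 nB]|[m mk cm]].
  have iB j : near3 k (iter (j * n) phi c) c.
    elim: j => [|j IH]; first exact: near3_refl.
    by rewrite mulSn iterD; apply: nB; exists (iter (j * n) phi c).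
  (* A multiple of the period that is at least k + 3, as [B1_catch] demands. *)
  have [|m /andP[mk _] cm] := B1_catch al (n := (k + 3) * n) c1 _ (leqnn k.*2.+1).
    by rewrite leq_pmulr.
  by exists m => //; exact: near3_trans (near3_sym (iB _)) cm.
have -> : ball3 k c = ball3 k (w m) by apply/cball_eqP.
exists (3 ^ k)%N; first by rewrite expn_gt0.
apply: classical_sets.subset_trans (image_ball_base mk) _; apply/ball3_sub => //.
apply: base_orbit_near3 => //; first exact: leq_trans mk (leq_addl _ _).
by rewrite modnDl.
Qed.

Lemma card_image_I (T : Type) (f : nat -> T) (A : set T) n :
  A = f @` `I_n -> (forall i j, (i < n)%N -> (j < n)%N -> f i = f j -> i = j) ->
  A #= `I_n.
Proof.
move=> -> f_inj; apply: inj_card_eq => i j; rewrite !inE; exact: f_inj.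
Qed.

Lemma card_balls_third : (balls_in B1 3^-1 `\ B11) #= `I_8.
Proof.
(* Index i stands for the centre (i / 3, i mod 3), and [bump 4] skips 4, the index of (1, 1). *)
pose f i : set (Q3sq R) := ball3 0 (Z3pair R (bump 4 i %/ 3)%:R (bump 4 i %% 3)%:R).
have dvd1 (i j : nat) : (i < 3)%N -> (j < 3)%N -> dvd3 1 (i%:R - j%:R) -> i = j.
  move=> i3 j3 /dvd3_res; rewrite res3D res3N !res3_nat expr1.
  by case: i i3 => [|[|[|]]]; case: j j3 => [|[|[|]]].
have f_inj i j : (i < 9)%N -> (j < 9)%N ->
    near3 0 (Z3pair R (i %/ 3)%:R (i %% 3)%:R) (Z3pair R (j %/ 3)%:R (j %% 3)%:R) -> i = j.
  move=> i9 j9 /near3_pair[/dvd1 h1 /dvd1 h2].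
  by rewrite (divn_eq i 3) (divn_eq j 3) h1 ?ltn_divLR // h2 ?ltn_pmod.
have bump9 i : (i < 8)%N -> (bump 4 i < 9)%N by rewrite /bump; lia.
apply: (@card_image_I _ f); last first.
  by move=> i j /bump9 i8 /bump9 j8 /cball_eqP/(f_inj _ _ i8 j8)/(can_inj (bumpK 4)).
apply/seteqP; split=> [B [[[c ->] cB]]|_ [i /= i8 <-]].
  rewrite B11E -(expr1 3) => cB11; have /(@ball3_B1 0)/unit_ballP[x [y cE]] : ball3 0 c `<=` B1.
    by rewrite expr1.
  have [c1 [i i3 xE]] := modn3P x; have [c2 [j j3 yE]] := modn3P y.
  have cij : near3 0 c (Z3pair R i%:R j%:R).
    rewrite cE xE yE; apply/near3_pair.
    by split; [exists c1|exists c2]; rewrite addrK.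
  have ij4 : (4 != i * 3 + j)%N.
    apply/eqP => ij; apply: cB11; apply/cball_eqP; apply: near3_trans cij _.
    have [-> ->] : i = 1%N /\ j = 1%N by lia.
    by rewrite /Z3pair tofrac1; exact: near3_refl.
  exists (unbump 4 (i * 3 + j)); first by rewrite /unbump /=; lia.
  apply/cball_eqP; rewrite unbumpKcond eq_sym (negbTE ij4) /=.
  by rewrite divnMDl // divn_small // addn0 modnMDl modn_small //; exact: near3_sym.
have fB1 : f i `<=` B1 by apply/ball3_B1/unit_ballP; do 2!eexists.
split; first by split=> //; eexists; rewrite /f expr1.
rewrite B11E => /cball_eqP; rewrite (_ : (1, 1) = Z3pair R (4 %/ 3)%:R (4 %% 3)%:R); last first.
  by rewrite /Z3pair tofrac1.
by move=> /(f_inj _ 4 (bump9 _ i8) isT) => /eqP; rewrite eq_sym (negbTE (neq_bump _ _)).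
Qed.

Lemma strictly_preperiodic_third B :
  (balls_in B1 3^-1 `\ B11) B -> strictly_preperiodic phi B.
Proof.
move=> [[[c ->] cB] cB11]; move: cB cB11; rewrite B11E -{1 2 3}(expr1 3).
move=> /ball3_B1 c1 cB11 /(ball_periodicP 0 c1)[m _ cm]; apply: cB11.
apply/cball_eqP; apply: (near3_trans cm).
by have /B11_near3 := base_orbit_B11 R al m; rewrite /Z3pair tofrac1.
Qed.

Lemma ball_cycle_level k : exists c,
  let r := 3 ^- k.+1 in
  let C := ball_cycle phi r c (3 ^ k) in
  [/\ C `<=` balls_in B11 r, ball_min_period phi (cball c r) (3 ^ k) &
      forall B, (balls_in B11 r `\` C) B -> strictly_preperiodic phi B].
Proof.
(* From index 2k + 1 on, nearness at level k is congruence of indices modulo 3^k. *)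
exists (w k.*2.+1); split.
- move=> _ [i _ <-]; split; first by eexists.
  rewrite iter_base_orbit B11E; apply/ball3_sub => //.
  by have /B11_near3 := base_orbit_B11 R al (i + k.*2.+1); rewrite /Z3pair tofrac1.
- split; first by rewrite expn_gt0.
    apply: classical_sets.subset_trans (image_ball_base (leqnn _)) _; apply/ball3_sub => //.
    by apply: base_orbit_near3 => //; [exact: leq_addl | rewrite modnDl].
  move=> m m0 mB; apply: dvdn_leq => //.
  have /base_orbit_near3P : near3 k (w (m + k.*2.+1)) (w k.*2.+1).
    rewrite -iter_base_orbit; apply: mB; exists (w k.*2.+1) => //; exact: near3_refl.
  move=> /(_ (leq_addl _ _) (leqnn _)) /eqP.
  by rewrite -{2}(add0n k.*2.+1) eqn_modDr mod0n.
- move=> B [[[c ->] cB]] cC; have c1 : B1 c.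
    by apply/(@ball3_B1 k); exact: classical_sets.subset_trans cB (@B11_sub_B1 R).
  move=> /(ball_periodicP _ c1)[m mk cm]; apply: cC.
  exists ((m - k.*2.+1) %% 3 ^ k)%N; first by rewrite /= ltn_pmod // expn_gt0.
  rewrite iter_base_orbit; apply/cball_eqP/near3_sym; apply: (near3_trans cm).
  apply: base_orbit_near3 => //; first exact: leq_addl.
  by rewrite modnDml subnK.
Qed.

(** A class m modulo 3^k splits into the three classes m + i 3^k, i < 3, modulo 3^(k+1). *)
Lemma card_periodic_subballs k B : (0 < k)%N ->
  balls_in B1 (3 ^- k) B -> ball_periodic phi B ->
  [set B' | balls_in B (3 ^- k.+1) B' /\ ball_periodic phi B'] #= `I_3.
Proof.
case: k => // k _ [[c ->] /ball3_B1 c1] /(ball_periodicP _ c1)[m0 mk0 cm0].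
(* A multiple of 3^k carries the index past the bound of level k + 1. *)
pose m := (m0 + 3 ^ k * 3)%N.
have mk : (k.+1.*2.+1 <= m)%N by have := expn_gt0 3 k; rewrite /m; lia.
have {cm0} cm : near3 k c (w m).
  apply: (near3_trans cm0); apply: base_orbit_near3 => //; first by lia.
  by rewrite /m addnC mulnC modnMDl.
have mik i : (k.+1.*2.+1 <= m + i * 3 ^ k)%N := leq_trans mk (leq_addr _ _).
apply: (@card_image_I _ (fun i => ball3 k.+1 (w (m + i * 3 ^ k)%N))); last first.
  move=> i j i3 j3 /cball_eqP/base_orbit_near3P => /(_ (mik _) (mik _)) /eqP.
  rewrite eqn_modDl expnSr (mulnC i) (mulnC j) -!muln_modr eqn_pmul2l ?expn_gt0 //.
  by rewrite !modn_small // => /eqP.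
apply/seteqP; split=> [_ [[[c' ->] c'c]]|_ [i /= i3 <-]].
  have c'c1 := iffLR (ball3_sub _ _ (leqnSn k)) c'c.
  have c'1 := near3_B1 c1 c'c1.
  move=> /(ball_periodicP _ c'1)[n nk c'n].
  (* The added multiple of 3^(k+1) makes n' at least m, so that n' - m is a true difference, and
     keeps the class of n. *)
  pose n' := (n + 3 ^ k.+1 * m)%N.
  have nk' : (k.+1.*2.+1 <= n')%N := leq_trans nk (leq_addr _ _).
  have {}c'n : near3 k.+1 c' (w n').
    apply: (near3_trans c'n); apply: base_orbit_near3 => //.
    by rewrite /n' addnC mulnC modnMDl.
  have mn : (m <= n')%N.
    by apply: leq_trans (leq_addl _ _); rewrite leq_pmull // expn_gt0.
  have : near3 k (w n') (w m).
    apply: near3_trans (near3_sym (near3W (leqnSn k) c'n)) _.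
    exact: near3_trans c'c1 cm.
  move=> /base_orbit_near3P => /(_ _ _) /eqP; rewrite eqn_mod_dvd // => h.
  have /dvdnP[q qE] : (3 ^ k %| n' - m)%N by apply: h; lia.
  exists (q %% 3)%N; first by rewrite /= ltn_pmod.
  apply/cball_eqP/near3_sym; apply: (near3_trans c'n).
  apply: base_orbit_near3 => //; apply/eqP.
  rewrite -(subnKC mn) qE eqn_modDl expnSr (mulnC q) (mulnC (q %% 3)%N) -!muln_modr.
  by rewrite modn_mod.
split; first split; first by eexists.
  apply/ball3_sub => //; apply: near3_trans (near3_sym cm).
  apply: base_orbit_near3; [by have := mik i; lia | by lia |].
  by rewrite addnC modnMDl.
by apply/ball_periodicP; [exact: base_orbit_B1 | exists (m + i * 3 ^ k)%N => //; exact: near3_refl].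
Qed.

End periodic_balls.

(** * Size of J: Haar measure and cardinality *)

(** This supplies infinitely many distinct translation vectors. A positive k is nonzero modulo 3^k
    because k < 3^k. *)
Lemma Z3_natr_inj : injective (fun n : nat => n%:R : Z3).
Proof.
suff wl n m : (m <= n)%N -> n%:R = m%:R :> Z3 -> n = m.
  by move=> n m nm; have [/wl|/ltnW/wl h] := leqP m n; [exact | exact/esym/h].
move=> mn /eqP; rewrite -subr_eq0 -natrB // => /eqP.
move=> /(congr1 (fun x : Z3 => x (n - m)%N)); rewrite res3_0 res3_nat.
suff nz k : (0 < k)%N -> (k%:Z %% 3 ^+ k)%Z <> 0.
  move: mn; rewrite leq_eqVlt => /orP[/eqP -> //|mn].
  by have /nz : (0 < n - m)%N by rewrite subn_gt0.
move=> k0; rewrite modz_small; first by case: k k0.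
apply/andP; split=> //.
have -> : 3 ^+ k = (3 ^ k)%:Z :> int by rewrite -natz natrX natz.
by rewrite ltz_nat; exact: ltn_expl.
Qed.

Section henonJ_size.
Variables (R : realType) (al : Z3).
Local Notation "x %:Q3" := (FracField.tofrac x : Q3 R) (at level 2, format "x %:Q3").
Local Notation a := (2 + 9 * al)%:Q3.
Local Notation B1 := (unit_ball R).
Local Notation J := (henonJ a 3).
Local Notation w := (base_orbit R al).
Implicit Types z : Q3sq R.

Lemma open_borel (A : set (Q3sq R)) : open A -> measurable (A : set (borel (Q3sq R))).
Proof. by move=> oA; exact: sub_sigma_algebra. Qed.

Lemma closed_borel (A : set (Q3sq R)) : closed A -> measurable (A : set (borel (Q3sq R))).
Proof. by move=> /closed_openC/open_borel/measurableC; rewrite setCK. Qed.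

Lemma closed_translate z (A : set (Q3sq R)) : closed A -> closed [set z + x | x in A].
Proof.
move=> cA y yA; exists (y - z); last by rewrite addrC subrK.
apply: cA => U /nbhs_near3P[k kU].
have [|_ [[x xA <-] yx]] := yA [set y' | near3 k y y'].
  by apply/nbhs_near3P; exists k.
exists x; split=> //; apply: kU.
have {}yx : near3 k y (z + x) := yx.
by move: yx; rewrite /near3 opprD addrA.
Qed.

(* J is a graph over its first coordinate, so that its vertical translates are
   disjoint. *)
Lemma haar_henonJ (nu : {measure set (borel (Q3sq R)) -> \bar R}) :
  haar_measure nu -> nu (J : set (borel (Q3sq R))) = 0%E.
Proof.
move=> [nuT nuK _].
pose T n : set (borel (Q3sq R)) := [set Z3pair R 0 n%:R + x | x in (J : set (Q3sq R))].
have mJ := closed_borel (@henonJ_closed R al).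
have mT n : measurable (T n) := closed_borel (@closed_translate _ _ (@henonJ_closed R al)).
have tT : trivIset setT T.
  move=> n m _ _ [_ [[x xJ <-] [y yJ /eqP]]].
  rewrite xpair_eqE /= tofrac0 !add0r => /andP[/eqP xy1].
  rewrite (henonJ_fst yJ xJ xy1) => /eqP/addIr/eqP.
  by rewrite tofrac_eq => /eqP/Z3_natr_inj.
have TB n : T n `<=` B1.
  move=> _ [x xJ <-]; rewrite /unit_ball /cball /= subr0; apply: norm3D_le.
    have : B1 (Z3pair R 0 n%:R) by apply/unit_ballP; do 2!eexists.
    by rewrite /unit_ball /cball /= subr0.
  by have := henonJ_B1 xJ; rewrite /unit_ball /cball /= subr0.
have le_n n : (n%:R%:E * nu (J : set (borel (Q3sq R))) <= nu (B1 : set (borel (Q3sq R))))%E.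
  have <- : nu (\big[setU/set0]_(i < n) T i) = (n%:R%:E * nu (J : set (borel (Q3sq R))))%E.
    rewrite measure_bigsetU // (eq_bigr (fun=> nu (J : set (borel (Q3sq R))))).
      by rewrite sumr_const card_ord mule_natl.
    by move=> i _; exact: nuT.
  apply: le_measure; rewrite ?inE; first exact: bigsetU_measurable.
    exact: open_borel (@open_unit_ball R).
  by rewrite -bigcup_mkord => y [i _]; exact: TB.
have nuB : (nu (B1 : set (borel (Q3sq R))) < +oo)%E by exact: nuK (@compact_unit_ball R).
have nuJ0 : (0 <= nu (J : set (borel (Q3sq R))))%E by exact: measure_ge0.
have : (0 <= nu (B1 : set (borel (Q3sq R))))%E by exact: measure_ge0.
case: (nu (B1 : set (borel (Q3sq R)))) nuB le_n => [b _ le_n b0|//|_ _ //].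
(* The bound for n = 1 excludes the value +oo, and the bounds for all n exclude a positive one. *)
have := le_n 1%N; rewrite mul1e.
case: (nu (J : set (borel (Q3sq R)))) nuJ0 le_n => [c c0 le_n _|_ _ //|//].
have {}b0 : 0 <= b by rewrite -lee_fin.
have {}c0 : 0 <= c by rewrite -lee_fin.
congr EFin; apply/eqP.
rewrite eq_le c0 andbT leNgt; apply/negP => cp.
have /archi_boundP : 0 <= b / c by exact: divr_ge0.
by rewrite ltr_pdivrMr // ltNge => /negP; apply; have := le_n (Num.bound (b / c)); rewrite lee_fin.
Qed.

(** Sequences of digits 0 and 1 embed into Z_3 and, through the coding by indices, into J; Cantor's
    diagonal argument then applies. *)
Lemma henonJ_uncountable : ~ countable J.
Proof.
pose i (b : nat -> bool) k := (k.*2.+1 * 3 ^ k + \sum_(j < k) b j * 3 ^ j)%N.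
have lim b : exists z, J z /\ forall k, near3 k z (w (i b k)).
  apply: henonJ_lim => k.
    by apply: leq_trans (leq_addr _ _); rewrite leq_pmulr // expn_gt0.
  by rewrite /i big_ord_recr /= expnS mulnA !modnMDl addnC modnMDl.
have [h hP] := choice lim.
move=> /countable_injP[f f_inj].
have iP b k : (k.*2.+1 <= i b k)%N.
  by apply: leq_trans (leq_addr _ _); rewrite leq_pmulr // expn_gt0.
have fh_inj b b' : f (h b) = f (h b') -> b = b'.
  move=> /f_inj; rewrite !inE => /(_ (hP b).1 (hP b').1) hh.
  suff bb k : forall j, (j < k)%N -> b j = b' j by apply/funext => j; exact: (bb j.+1).
  elim: k => // k IH j; rewrite ltnS leq_eqVlt => /orP[/eqP ->|/IH //].
  have : near3 k.+1 (w (i b k.+1)) (w (i b' k.+1)).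
    by apply: near3_trans (near3_sym ((hP b).2 k.+1)) _; rewrite hh; exact: (hP b').2.
  move=> /base_orbit_near3P => /(_ (iP _ _) (iP _ _)).
  rewrite /i !modnMDl !big_ord_recr /= (eq_bigr (fun j : 'I_k => b' j * 3 ^ j)%N); last first.
    by move=> l _; rewrite IH.
  move/eqP; rewrite eqn_modDl expnSr -(mulnC (3 ^ k)%N) -(mulnC (3 ^ k)%N (b' k)).
  rewrite -!muln_modr eqn_pmul2l ?expn_gt0 //.
  by case: (b k) (b' k) => [] [].
(* By injectivity, [D] takes at f (h b) the value opposite to that of b, for every b. *)
pose D n := `[< exists b, f (h b) = n /\ ~~ b n >].
have : D (f (h D)) = ~~ D (f (h D)).
  apply/idP/idP => [/asboolP[b [/fh_inj bD]]|nD]; first by rewrite bD.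
  by apply/asboolP; exists D.
by case: (D _).
Qed.

End henonJ_size.

(** * The invariant measure *)

(* Base 3 digit reversal: it turns the nested triadic intervals of [0, 1[ into
   nested residue classes modulo powers of 3, so that Lebesgue measure is sent to
   Haar measure on Z_3. *)
Fixpoint rev3 k i :=
  if k is k'.+1 then (rev3 k' (i %/ 3) + 3 ^ k' * (i %% 3))%N else 0%N.

Lemma rev3_lt k i : (rev3 k i < 3 ^ k)%N.
Proof.
elim: k i => //= k IH i; rewrite expnSr.
by have := IH (i %/ 3)%N; have := ltn_pmod i (isT : 0 < 3)%N; nia.
Qed.

Lemma rev3_inj k i j : (i < 3 ^ k)%N -> (j < 3 ^ k)%N -> rev3 k i = rev3 k j -> i = j.
Proof.
elim: k i j => [|k IH] i j /=; first by case: i j => [|i] [|j].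
rewrite expnSr => ik jk E.
have k0 : (0 < 3 ^ k)%N by rewrite expn_gt0.
have E1 : rev3 k (i %/ 3) = rev3 k (j %/ 3).
  have /(congr1 (modn^~ (3 ^ k)%N)) := E.
  by rewrite ![(rev3 _ _ + _)%N]addnC ![(3 ^ k * _)%N]mulnC !modnMDl !modn_small ?rev3_lt.
rewrite (divn_eq i 3) (divn_eq j 3) (IH _ _ _ _ E1) ?ltn_divLR //.
by move: E; rewrite E1 => /addnI/eqP; rewrite eqn_pmul2l // => /eqP ->.
Qed.

Lemma rev3_surj k n : (n < 3 ^ k)%N -> exists2 i, (i < 3 ^ k)%N & rev3 k i = n.
Proof.
move=> nk; pose f (i : 'I_(3 ^ k)) := Ordinal (rev3_lt k i).
have f_inj : injective f.
  by move=> i j /(congr1 val)/= /(rev3_inj (ltn_ord i) (ltn_ord j))/val_inj.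
have [g _ fK] := injF_bij f_inj.
by exists (g (Ordinal nk)) => //; have /(congr1 val) := fK (Ordinal nk).
Qed.

Section base_measure.
Variables (R : realType) (al : Z3).
Local Notation "x %:Q3" := (FracField.tofrac x : Q3 R) (at level 2, format "x %:Q3").
Local Notation a := (2 + 9 * al)%:Q3.
Local Notation B1 := (unit_ball R).
Local Notation J := (henonJ a 3).
Local Notation w := (base_orbit R al).
Implicit Types (z : Q3sq R) (t : R).

(** For t in [0, 1[ its base 3 digits are the first k triadic digits of t. Points can be attached to
    all other t as well, because [rev3 k] reads only the k lowest digits. *)
Definition floor3 k t : nat := Num.truncn (3 ^+ k * t).

Lemma floor3_gt k t n : (n < floor3 k t)%N = (n.+1%:R <= 3 ^+ k * t).
Proof. by rewrite ltnNge truncn_le_nat leNgt. Qed.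

(** Division by 3 deletes the last triadic digit; this makes [base_index] coherent in k. *)
Lemma floor3_div k t : (floor3 k.+1 t %/ 3)%N = floor3 k t.
Proof.
suff lt n : (n < floor3 k.+1 t %/ 3)%N = (n < floor3 k t)%N.
  apply/eqP; rewrite eqn_leq; apply/andP.
  by split; rewrite leqNgt; apply/negP; [rewrite lt | rewrite -lt]; rewrite ltnn.
rewrite leq_divRL // -[(n.+1 * 3)%N]/((n * 3).+3) !floor3_gt exprS -mulrA.
have -> : (n * 3).+3%:R = 3 * n.+1%:R :> R by rewrite -natrM (mulnC 3).
by rewrite ler_pM2l // ltr0n.
Qed.

Lemma measurable_floor3 k i : measurable [set t | floor3 k t = i].
Proof.
have m_ge j : measurable [set t : R | (j < floor3 k t)%N].
  rewrite (_ : [set t | _] = `[3 ^- k * j.+1%:R, +oo[%classic); first exact: measurable_itv.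
  apply/seteqP; split=> t /=;
    by rewrite floor3_gt in_itv /= andbT ler_pdivrMl ?exprn_gt0.
have E : [set t | floor3 k t = i] =
    (if i is i'.+1 then [set t | (i' < floor3 k t)%N] else setT)
    `\` [set t | (i < floor3 k t)%N].
  case: i => [|i]; apply/seteqP; split=> t /=.
  - by move=> ->; split.
  - by move=> [_ /negP]; rewrite -leqNgt leqn0 => /eqP.
  - by move=> ->; rewrite ltnSn ltnn; split.
  - by move=> [h1 /negP]; rewrite -leqNgt => h2; apply/eqP; rewrite eqn_leq h1 h2.
by rewrite E; apply: measurableD => //; case: i {E}.
Qed.

Lemma lebesgue_floor3 k i : (i < 3 ^ k)%N ->
  lebesgue_measure ([set t : R | floor3 k t = i] `&` `[0, 1[) = (3 ^- k)%:E.
Proof.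
move=> ik; have p0 : 0 < 3 ^+ k :> R by rewrite exprn_gt0.
rewrite (_ : _ `&` _ = `[3 ^- k * i%:R, 3 ^- k * i.+1%:R[%classic).
  rewrite lebesgue_measure_itv /= lte_fin ltr_pM2l ?invr_gt0 // ltr_nat ltnSn.
  by rewrite -EFinB -mulrBr -natrB // subSnn mulr1.
apply/seteqP; split=> t /=; rewrite !in_itv /= ler_pdivrMl // ltr_pdivlMl //.
  move=> [fi /andP[t0 t1]]; rewrite -truncn_le_nat -[Num.truncn _]/(floor3 k t) fi leqnn andbT.
  case: i fi {ik} => [|i] fi; first by rewrite mulr_ge0 // ltW.
  by rewrite -floor3_gt fi.
move=> /andP[t0 t1].
have tge0 : 0 <= t by rewrite -(pmulr_rge0 _ p0) (le_trans _ t0).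
split; last first.
  rewrite tge0 /= -(ltr_pM2l p0) mulr1; apply: (lt_le_trans t1).
  by rewrite -natrX ler_nat.
apply/eqP; rewrite eqn_leq /floor3 truncn_le_nat t1 /=.
by rewrite truncn_ge_nat // mulr_ge0 // ltW.
Qed.

(** The reversed digits give the class modulo 3^k; the first summand only lifts the index to at
    least 2k + 1. *)
Definition base_index k t : nat := (k.*2.+1 * 3 ^ k + rev3 k (floor3 k t))%N.

Lemma base_index_ge k t : (k.*2.+1 <= base_index k t)%N.
Proof. by apply: leq_trans (leq_addr _ _); rewrite leq_pmulr // expn_gt0. Qed.

Lemma base_point t : exists z, J z /\ forall k, near3 k z (w (base_index k t)).
Proof.
apply: (@henonJ_lim R al (base_index^~ t)) => k; first exact: base_index_ge.
by rewrite /base_index /= floor3_div expnS mulnA !modnMDl addnC mulnC modnMDl.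
Qed.

End base_measure.

Section unit_lebesgue.
Variable R : realType.

Definition unit_lebesgue : set _ -> \bar R :=
  mrestr lebesgue_measure (measurable_itv `[(0 : R), 1[).

HB.instance Definition _ := Measure.copy unit_lebesgue
  (mrestr (@lebesgue_measure R) (measurable_itv `[(0 : R), 1[)).

Lemma unit_lebesgue_setT : unit_lebesgue setT = 1%E.
Proof.
by rewrite /unit_lebesgue /mrestr setTI lebesgue_measure_itv /= lte_fin ltr01 sube0.
Qed.

HB.instance Definition _ :=
  Measure_isProbability.Build _ _ _ unit_lebesgue unit_lebesgue_setT.

End unit_lebesgue.

Section base_measure_exists.
Variables (R : realType) (al : Z3).
Local Notation "x %:Q3" := (FracField.tofrac x : Q3 R) (at level 2, format "x %:Q3").
Local Notation a := (2 + 9 * al)%:Q3.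
Local Notation J := (henonJ a 3).
Local Notation w := (base_orbit R al).

(** The measure is the image of Lebesgue measure on [0, 1[ under the map [h] to J that codes points
    by reversed triadic digits. *)
Lemma base_measure_exists : exists mu : probability (borel (Q3sq R)) R,
  mu (J : set (borel (Q3sq R))) = 1%E /\
  forall k m, (k.*2.+1 <= m)%N ->
    mu ([set z | near3 k z (w m)] : set (borel (Q3sq R))) = (3 ^- k)%:E.
Proof.
have [h hP] := choice (@base_point R al).
have hnear k t t' : floor3 k t = floor3 k t' -> near3 k (h t) (h t').
  move=> tt'; apply: near3_trans ((hP t).2 k) _.
  by rewrite /base_index tt'; exact/near3_sym/(hP t').2.
have mh : measurable_fun setT (h : measurableTypeR R -> borel (Q3sq R)).
  apply: (@measurability _ _ (measurableTypeR R) (borel (Q3sq R)) _ _ (@open (Q3sq R))).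
    by [].
  move=> _ [U oU <-].
  pose C k i : set R := [set t | floor3 k t = i].
  (* Equal leading digits give near points, so the preimage of an open set is the union of those
     among the countably many cells [C k i] that it contains. *)
  rewrite setTI (_ : h @^-1` U = \bigcup_k \bigcup_i
     (if pselect (C k i `<=` h @^-1` U) then C k i else set0)).
    apply: bigcupT_measurable => k; apply: bigcupT_measurable => i.
    by case: pselect => H; [exact: measurable_floor3 | exact: measurable0].
  apply/seteqP; split=> [t /= Ut|t [k _ [i _]]]; last first.
    by case: pselect => [H /= /H|].
  have [k kO] : exists k, forall z', near3 k (h t) z' -> U z'.
    by apply/nbhs_near3P; exact: open_nbhs_nbhs.
  exists k => //; exists (floor3 k t) => //; case: pselect => // -[].
  by move=> t' /= tt'; apply: kO; apply: hnear.
pose hX := isMeasurableFun.Build _ _ (measurableTypeR R) (borel (Q3sq R)) h mh.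
pose X : {mfun (measurableTypeR R) >-> borel (Q3sq R)} :=
  HB.pack_for {mfun (measurableTypeR R) >-> borel (Q3sq R)} h hX.
exists (distribution (@unit_lebesgue R) X); split.
  rewrite /distribution /pushforward /= (_ : _ @^-1` _ = setT) ?unit_lebesgue_setT //.
  by apply/seteqP; split=> // t _; exact: (hP t).1.
move=> k m mk; have p0 : (0 < 3 ^ k)%N by rewrite expn_gt0.
have [i ik ri] := rev3_surj (ltn_pmod m p0).
rewrite -(lebesgue_floor3 R ik); congr (lebesgue_measure _).
have nearP t : near3 k (h t) (w m) <-> rev3 k (floor3 k t) = (m %% 3 ^ k)%N.
  have -> : rev3 k (floor3 k t) = (base_index k t %% 3 ^ k)%N.
    by rewrite /base_index modnMDl modn_small // rev3_lt.
  rewrite -(base_orbit_near3P R al (base_index_ge k t) mk).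
  by split; apply: near3_trans; [apply: near3_sym|]; exact: (hP t).2.
apply/seteqP; split=> t [tA t01]; split=> //; last by apply/nearP; rewrite tA.
(* From t < 1 comes floor3 k t < 3^k, the range in which [rev3 k] is injective. *)
move: t01 => /=; rewrite in_itv /= => /andP[_ t1].
have /nearP := tA; rewrite -ri => /rev3_inj; apply=> //.
rewrite -(prednK p0) ltnS truncn_le_nat prednK // natrX.
by rewrite -[ltRHS]mulr1 ltr_pM2l ?exprn_gt0.
Qed.

End base_measure_exists.

(** * Time averages of continuous functions *)

(** Blocks of length K are split off; the fewer than K terms left over cost at most K M. *)
Lemma cesaro_bound (R : realType) (G : nat -> R) (M e : R) K i0 n :
  (0 < K)%N -> 0 <= e -> (forall i, `|G i| <= M) ->
  (forall i, (i0 <= i)%N -> `|\sum_(j < K) G (i + j)%N| <= K%:R * e) ->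
  `|\sum_(j < n) G (i0 + j)%N| <= n%:R * e + K%:R * M.
Proof.
move=> K0 e0 GM; have M0 : 0 <= M := le_trans (normr_ge0 _) (GM 0%N).
elim/ltn_ind: n i0 => n IH i0 Ge; have [nK|Kn] := ltnP n K.
  apply: le_trans (ler_norm_sum _ _ _) _.
  apply: le_trans (_ : \sum_(j < n) M <= _); first exact: ler_sum.
  rewrite sumr_const card_ord -[leLHS]mulr_natl; apply: ler_wpDl; first exact: mulr_ge0.
  by apply: ler_wpM2r => //; rewrite ler_nat ltnW.
rewrite -(subnKC Kn) big_split_ord /=; apply: le_trans (ler_normD _ _) _.
rewrite natrD mulrDl -addrA lerD ?Ge //.
rewrite (eq_bigr (fun j : 'I__ => G (i0 + K + j)%N)); last by move=> j _; rewrite addnA.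
apply: IH; first by rewrite ltn_subrL K0 (leq_trans K0 Kn).
by move=> i i0K; apply: Ge; exact: leq_trans (leq_addr _ _) i0K.
Qed.

Section continuous_on_unit_ball.
Variables (R : realType) (f : Q3sq R -> R).
Local Notation B1 := (unit_ball R).
Hypothesis cf : {within B1, continuous f}.

Lemma unit_ball_continuous x : B1 x -> {for x, continuous f}.
Proof.
move=> x1; move: cf; rewrite continuous_open_subspace; last exact: open_unit_ball.
by apply; rewrite inE.
Qed.

Lemma unit_ball_modulus x e : B1 x -> 0 < e ->
  exists k, forall y, near3 k x y -> `|f x - f y| < e.
Proof.
move=> x1 e0; have /cvgrPdist_lt/(_ e e0) := unit_ball_continuous x1.
by move=> /nbhs_near3P.
Qed.

(** By the ultrametric inequality, a modulus for e / 2 at one point serves all points of a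
    neighbourhood with e, and compactness makes it uniform. *)
Lemma unit_ball_uniform e : 0 < e ->
  exists k, forall x y, B1 x -> near3 k x y -> `|f x - f y| <= e.
Proof.
move=> e0; have /compact_near_coveringP := @compact_unit_ball R.
move=> /(_ nat (nbhs \oo) (fun k x => forall y, near3 k x y -> `|f x - f y| <= e) _).
case=> [x x1|k _ kP]; last by exists k => x y x1; exact: (kP k (leqnn k) x x1).
have [k kP] := unit_ball_modulus x1 (divr_gt0 e0 (ltr0n _ 2)).
exists ([set x' | near3 k x x'], [set n | (k <= n)%N]) => /=.
  by split; [apply/nbhs_near3P; exists k | exists k].
move=> [x' n] /= [xx' kn] y x'y.
have x'y' := near3W kn x'y; have xy := near3_trans xx' x'y'.
rewrite -(subrKA (f x)) [leRHS]splitr; apply: le_trans (ler_normD _ _) _.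
by apply: lerD; apply: ltW; [rewrite distrC; exact: kP|exact: kP].
Qed.

Lemma unit_ball_bounded : exists M, forall x, B1 x -> `|f x| <= M.
Proof.
have /compact_near_coveringP := @compact_unit_ball R.
move=> /(_ nat (nbhs \oo) (fun k x => `|f x| <= k%:R) _).
case=> [x x1|k _ kP]; last by exists k%:R => x x1; exact: (kP k (leqnn k) x x1).
have [k kP] := unit_ball_modulus x1 ltr01.
exists ([set x' | near3 k x x'], [set n | (Num.bound (`|f x| + 1) <= n)%N]) => /=.
  by split; [apply/nbhs_near3P; exists k | exists (Num.bound (`|f x| + 1))].
move=> [x' n] /= [/kP xx' kn].
have /archi_boundP h : 0 <= `|f x| + 1 by rewrite addr_ge0.
have hn : (Num.bound (`|f x| + 1))%:R <= n%:R :> R by rewrite ler_nat.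
have : `|f x'| <= `|f x| + `|f x - f x'|.
  by rewrite -{1}(subrK (f x) (f x')) addrC (le_trans (ler_normD _ _)) // distrC.
by move: h hn xx'; lra.
Qed.

Lemma unit_ball_measurable :
  measurable_fun (B1 : set (borel (Q3sq R))) (f : borel (Q3sq R) -> R).
Proof.
apply: (measurability _ (RGenOpens.measurableE R)).
move=> _ [_ [a [b ->] <-]]; apply: open_borel; rewrite openE => x [x1 fx].
have /nbhs_near3P[k kP] : nbhs x (f @^-1` `]a, b[%classic).
  by apply: (unit_ball_continuous x1); apply: open_nbhs_nbhs; split => //; exact: interval_open.
apply/nbhs_near3P; exists k => y xy; split; last exact: kP.
exact: near3_B1 x1 (near3_sym xy).
Qed.

End continuous_on_unit_ball.

Section ball_integral.
Variables (R : realType) (mu : probability (borel (Q3sq R)) R) (f : Q3sq R -> R).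
Local Notation B1 := (unit_ball R).
Hypothesis cf : {within B1, continuous f}.

Lemma unit_ball_integrable (D : set (borel (Q3sq R))) : measurable D -> D `<=` B1 ->
  mu.-integrable D (EFin \o f).
Proof.
move=> mD DB; apply: measurable_bounded_integrable => //.
- by rewrite (le_lt_trans (probability_le1 mu mD)) // ltry.
- apply: measurable_funS (unit_ball_measurable cf) => //.
  exact: open_borel (@open_unit_ball R).
- have [M fM] := unit_ball_bounded cf; exists M; split; first exact: num_real.
  by move=> M' MM' x Dx; apply: le_trans (ltW MM'); apply: fM; exact: DB.
Qed.

Lemma integral_near_const (D : set (borel (Q3sq R))) (v e p : R) :
  measurable D -> D `<=` B1 -> mu D = p%:E -> (forall x, D x -> `|f x - v| <= e) ->
  exists2 I : R, (\int[mu]_(x in D) (f x)%:E)%E = I%:E & `|I - v * p| <= e * p.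
Proof.
move=> mD DB Dp fv; have fi := unit_ball_integrable mD DB.
have ci (c : R) : mu.-integrable D (cst c%:E).
  apply: (measurable_bounded_integrable (f := cst c)) => //.
    by rewrite (le_lt_trans (probability_le1 mu mD)) // ltry.
  by exists `|c|; split => // M' cM' x _; exact: ltW.
have /fineK <- := integrable_fin_num mD fi; eexists; first by [].
have le1 : (((v - e) * p)%:E <= \int[mu]_(x in D) (f x)%:E)%E.
  rewrite EFinM -Dp -integral_cst //; apply: le_integral => // x; rewrite inE => Dx.
  by rewrite lee_fin; have := fv x Dx; rewrite ler_norml => /andP[]; lra.
have le2 : (\int[mu]_(x in D) (f x)%:E <= ((v + e) * p)%:E)%E.
  rewrite EFinM -Dp -integral_cst //; apply: le_integral => // x; rewrite inE => Dx.
  by rewrite lee_fin; have := fv x Dx; rewrite ler_norml => /andP[]; lra.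
have /fineK E := integrable_fin_num mD fi.
move: le1 le2; rewrite -E !lee_fin /= !(mulrDl, mulNr) => le1 le2.
by rewrite ler_norml; apply/andP; split; lra.
Qed.

End ball_integral.

Section ergodic_averages.
Variables (R : realType) (al : Z3).
Local Notation "x %:Q3" := (FracField.tofrac x : Q3 R) (at level 2, format "x %:Q3").
Local Notation a := (2 + 9 * al)%:Q3.
Local Notation phi := (henon a 3).
Local Notation B1 := (unit_ball R).
Local Notation w := (base_orbit R al).
Variables (mu : probability (borel (Q3sq R)) R) (f : Q3sq R -> R).
Hypothesis mu_ball : forall k m, (k.*2.+1 <= m)%N ->
  mu ([set z | near3 k z (w m)] : set (borel (Q3sq R))) = (3 ^- k)%:E.
Hypothesis cf : {within B1, continuous f}.

(** A block of 3^k iterates meets each of the 3^k classes once. A class has mass 3^-k, and over it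
    the integral of f is 3^-k times f at that iterate, up to e 3^-k. *)
Lemma block_average e : 0 < e -> exists k, forall z i, B1 z -> (k + 3 <= i)%N ->
  `|\sum_(j < 3 ^ k) (f (iter (i + j) phi z) - fine (\int[mu]_(x in B1) (f x)%:E)%E)|
    <= (3 ^ k)%:R * e.
Proof.
move=> e0; have [k kP] := unit_ball_uniform cf e0; exists k => z i z1 ik.
have [m /andP[mk _] zm] := B1_catch al z1 ik (leqnn k.*2.+1).
have zj j : near3 k (iter (i + j) phi z) (w (j + m)).
  by rewrite addnC iterD; apply: iter_near_base => //; exact: iter_henon_B1.
pose D (j : 'I_(3 ^ k)) : set (borel (Q3sq R)) := [set x | near3 k x (w (j + m))].
have jmk j : (k.*2.+1 <= j + m)%N := leq_trans mk (leq_addl _ _).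
have mD j : measurable (D j) by apply: open_borel; exact: open_near3.
have DB j : D j `<=` B1 by move=> x; apply: near3_B1; exact: base_orbit_B1.
have tD : trivIset setT D.
  move=> j l _ _ [x [xj xl]]; apply/val_inj.
  have /base_orbit_near3P := near3_trans (near3_sym xj) xl.
  by move=> /(_ (jmk _) (jmk _)) /eqP; rewrite eqn_modDr !modn_small // => /eqP.
pose U := \big[setU/set0]_(j < 3 ^ k) D j.
have mU : measurable U by exact: bigsetU_measurable.
have UB : U `<=` B1.
  by rewrite /U; elim/big_ind : _ => // A B AB BB x [/AB|/BB].
have mB : measurable (B1 : set (borel (Q3sq R))) by exact: open_borel (@open_unit_ball R).
have muU : mu U = 1%E.
  rewrite /U measure_bigsetU_ord // (eq_bigr (fun=> (3 ^- k)%:E)) => [|j _]; last exact: mu_ball.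
  by rewrite sumEFin sumr_const card_ord -[3 ^- k *+ _]mulr_natl natrX mulfV //.
(* The 3^k disjoint balls have total mass 1, so the rest of the unit ball does not affect the
   integral. *)
have N0 : mu (B1 `\` U) = 0%E.
  apply/eqP; rewrite eq_le measure_ge0 andbT.
  rewrite -[leRHS](_ : mu (~` U) = 0%E); last first.
    by rewrite probability_setC // muU subee.
  apply: le_measure; rewrite ?inE; [exact: measurableD|exact: measurableC|].
  by move=> x [].
have B1U : B1 `&` U = U.
  by apply/seteqP; split=> [x []//|x Ux]; split=> //; exact: UB.
have IE : (\int[mu]_(x in B1) (f x)%:E = \sum_(j < 3 ^ k) \int[mu]_(x in D j) (f x)%:E)%E.
  rewrite (@negligible_integral _ _ _ mu B1 (B1 `\` U)) //; last 2 first.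
  - exact: measurableD.
  - exact: unit_ball_integrable.
  rewrite setDD B1U integral_bigsetU_EFin ?index_enum_uniq //.
    by apply: sub_trivIset tD.
  by apply/measurable_EFinP; exact: measurable_funS mB UB (unit_ball_measurable cf).
have Ij j : exists I : R, (\int[mu]_(x in D j) (f x)%:E)%E = I%:E /\
    `|I - f (iter (i + j) phi z) * 3 ^- k| <= e * 3 ^- k.
  have [x xD|I IE' Ile] := integral_near_const cf (v := f (iter (i + j) phi z))
      (e := e) (mD j) (@DB j) (mu_ball (jmk j)).
    rewrite distrC; apply: kP; first exact: iter_henon_B1.
    exact: near3_trans (zj j) (near3_sym xD).
  by exists I.
have [I IP] := choice Ij.
rewrite IE (eq_bigr (fun j => (I j)%:E)) => [|j _]; last exact: (IP j).1.
(* The 3^k copies of the whole integral are regrouped as 3^k copies of each [I j], to compare term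
   by term. *)
rewrite sumEFin /= sumrB sumr_const card_ord -sumrMnl -sumrB.
apply: le_trans (ler_norm_sum _ _ _) _.
apply: le_trans (_ : \sum_(j < 3 ^ k) e <= _); last first.
  by rewrite sumr_const card_ord -[leLHS]mulr_natl.
apply: ler_sum => j _.
have p0 : 0 < 3 ^+ k :> R by rewrite exprn_gt0.
have [_] := IP j; rewrite -ler_pdivrMr ?invr_gt0 // invrK -[X in _ * X](gtr0_norm p0) -normrM.
by rewrite mulrBl divfK ?gt_eqF // distrC -[I j *+ _]mulr_natr natrX.
Qed.

End ergodic_averages.

Lemma cesaro_cvg0 (R : realType) (G : nat -> R) (M : R) :
  (forall i, `|G i| <= M) ->
  (forall e, 0 < e -> exists i0 K, (0 < K)%N /\ forall i, (i0 <= i)%N ->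
     `|\sum_(j < K) G (i + j)%N| <= K%:R * e) ->
  n%:R^-1 * \sum_(j < n) G j.+1 @[n --> \oo] --> (0 : R).
Proof.
move=> GM Ge; apply/cvgrPdist_le => e e0.
have M0 : 0 <= M := le_trans (normr_ge0 _) (GM 0%N).
have e20 : 0 < e / 2 by exact: divr_gt0.
have [i0 [K [K0 blocks]]] := Ge _ e20.
have tail n := @cesaro_bound R (fun i => G i.+1) M (e / 2) K i0 n K0 (ltW e20)
  (fun i => GM i.+1) (fun i ii0 => blocks i.+1 (leqW ii0)).
(* The error that does not grow with n: the first i0 terms and the incomplete block. *)
pose C := (i0 + K)%:R * M; have C0 : 0 <= C by exact: mulr_ge0.
exists (i0 + (Num.bound (C / (e / 2))).+1)%N => // n /= nN.
have n0 : 0 < n%:R :> R by rewrite ltr0n; lia.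
have Cn : C <= n%:R * (e / 2).
  rewrite -ler_pdivrMr //; apply: ltW; apply: lt_le_trans (archi_boundP _) _.
    exact: divr_ge0 (ltW e20).
  by rewrite ler_nat; apply: ltnW; apply: leq_trans nN; exact: leq_addl.
rewrite sub0r normrN normrM (gtr0_norm (_ : 0 < n%:R^-1)) ?invr_gt0 //.
rewrite mulrC ler_pdivrMr // (mulrC e).
have ni0 : (i0 <= n)%N by apply: leq_trans nN; exact: leq_addr.
rewrite -(subnKC ni0) big_split_ord /= (subnKC ni0); apply: le_trans (ler_normD _ _) _.
have head : `|\sum_(j < i0) G j.+1| <= i0%:R * M.
  apply: le_trans (ler_norm_sum _ _ _) _.
  apply: le_trans (_ : \sum_(j < i0) M <= _); first exact: ler_sum.
  by rewrite sumr_const card_ord -[leLHS]mulr_natl.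
have := tail (n - i0)%N.
have le_n : (n - i0)%:R * (e / 2) <= n%:R * (e / 2).
  by apply: ler_wpM2r; [exact: ltW | rewrite ler_nat leq_subr].
move: head Cn le_n; rewrite /C natrD mulrDl.
set x := `|_|; set y := `|_|; set q := _ * (e / 2); set q' := _ * (e / 2).
have -> : n%:R * e = q + q by rewrite /q -mulrDr -splitr.
lra.
Qed.

Section ergodic_theorem.
Variables (R : realType) (al : Z3).
Local Notation "x %:Q3" := (FracField.tofrac x : Q3 R) (at level 2, format "x %:Q3").
Local Notation a := (2 + 9 * al)%:Q3.
Local Notation phi := (henon a 3).
Local Notation B1 := (unit_ball R).
Local Notation w := (base_orbit R al).

Lemma ergodic_average (mu : probability (borel (Q3sq R)) R) (f : Q3sq R -> R) z :
  (forall k m, (k.*2.+1 <= m)%N ->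
    mu ([set z | near3 k z (w m)] : set (borel (Q3sq R))) = (3 ^- k)%:E) ->
  B1 z -> {within B1, continuous f} ->
  (n%:R^-1 * \sum_(1 <= i < n.+1) f (iter i phi z))%:E @[n --> \oo]
    --> (\int[mu]_(x in B1) (f x)%:E)%E.
Proof.
move=> mu_ball z1 cf.
have mB : measurable (B1 : set (borel (Q3sq R))) by exact: open_borel (@open_unit_ball R).
have /fineK <- := integrable_fin_num mB (unit_ball_integrable mu cf mB (@subset_refl _ B1)).
set L := fine _.
have [M fM] := unit_ball_bounded cf.
apply/fine_cvgP; split; first by exists 0%N.
pose G i := f (iter i phi z) - L.
have GM i : `|G i| <= M + `|L|.
  apply: le_trans (ler_normB _ _) _; rewrite lerD2r; apply: fM.
  exact: iter_henon_B1.
have : n%:R^-1 * \sum_(j < n) G j.+1 @[n --> \oo] --> (0 : R).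
  apply: cesaro_cvg0 GM _ => e e0.
  have [k kP] := block_average mu_ball cf e0.
  exists (k + 3)%N, (3 ^ k)%N; split; first by rewrite expn_gt0.
  by move=> i; exact: kP.
move=> /cvgrPdist_le G0; apply/cvgrPdist_le => e e0.
(* The bound N.+1 ensures n > 0, so that the n copies of [L] average to [L]. *)
have [N _ NP] := G0 e e0; exists N.+1 => // n /= Nn.
have := NP n (ltnW Nn); rewrite sub0r normrN => {NP}; apply: le_trans.
have n0 : n%:R != 0 :> R by rewrite pnatr_eq0; lia.
rewrite distrC big_add1 /= big_mkord sumrB sumr_const card_ord -[L *+ _]mulr_natl.
by rewrite mulrBr mulKf.
Qed.

End ergodic_theorem.

(** The metric condition on a becomes a parameter in Z_3, over which the preceding arguments are
    polynomial identities. *)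
Lemma henon_parameter (R : realType) (a : Q3 R) : abs3 (a - 2) <= 9^-1 ->
  exists al : Z3, a = FracField.tofrac (2 + 9 * al).
Proof.
have -> : 9^-1 = 3 ^- 2 :> R by rewrite -natrX.
move=> a9; have [t at2] : exists t : Z3, a - 2 = FracField.tofrac t.
  by apply: abs3_le1; apply: le_trans a9 _; rewrite invf_le1 ?exprn_gt0 // exprn_ege1 // ler1n.
move: a9; rewrite at2 abs3_tofrac => /absZ3_le[c tE]; exists c.
rewrite -(subrK 2 a) at2 tE tofracD addrC; congr (_ + FracField.tofrac _).
  by rewrite rmorph_nat.
by congr (_ * _); rewrite -natrX.
Qed.

Unset Implicit Arguments.

Theorem theorem4p8 (R : realType) (a : Q3 R) (ha : abs3 (a - 2) <= 9^-1) :
  let phi := henon a 3 in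
  let J := henonJ a 3 in
  let B1 := unit_ball R in
  let B11 := cball ((1, 1) : Q3sq R) 3^-1 in
  (* (a) *)
  [/\ phi @` B11 `<=` B11,
      balls_in B1 3^-1 `\ B11 #= `I_8 /\
        (forall B, (balls_in B1 3^-1 `\ B11) B -> strictly_preperiodic phi B),
      (forall k : nat, (0 < k)%N ->
        exists c : Q3sq R,
          let r := 3 ^- k.+1 in
          let C := ball_cycle phi r c (3 ^ k) in
          [/\ C `<=` balls_in B11 r,
              ball_min_period phi (cball c r) (3 ^ k) &
              forall B, (balls_in B11 r `\` C) B -> strictly_preperiodic phi B]) &
      (forall (k : nat) (B : set (Q3sq R)), (0 < k)%N ->
        balls_in B1 (3 ^- k) B -> ball_periodic phi B ->
        [set B' | balls_in B (3 ^- k.+1) B' /\ ball_periodic phi B'] #= `I_3)]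
  (* (b) *)
  /\ ([/\ attractor phi J,
          ~ countable J,
          measurable (J : set (borel (Q3sq R))) /\
            (forall nu : {measure set (borel (Q3sq R)) -> \bar R},
              haar_measure nu -> nu J = 0%E) &
          (forall z, J z -> forall n : nat, (0 < n)%N -> iter n phi z <> z)]
      /\ (forall z, J z -> has_dense_forward_orbit_in phi J z)
      /\ indecomposable phi J)
  (* (c) *)
  /\ (exists mu : probability (borel (Q3sq R)) R,
        mu J = 1%E /\
        forall (z : Q3sq R) (f : Q3sq R -> R),
          B1 z -> {within B1, continuous f} ->
          (n%:R^-1 * \sum_(1 <= i < n.+1) f (iter i phi z))%:E @[n --> \oo]
            --> (\int[mu]_(x in B1) (f x)%:E)%E).
Proof.
move=> phi J B1 B11; have [al aE] := henon_parameter ha.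
rewrite {ha} aE in phi J *; split; last split; last first.
- have [mu [muJ muB]] := base_measure_exists R al; exists mu; split=> // z f z1 cf.
  exact: ergodic_average muB z1 cf.
- split; last first.
    by split; [move=> z zJ; exact: henonJ_dense_orbit | exact: henonJ_indecomposable].
  split; first exact: attractor_henonJ.
  + exact: henonJ_uncountable.
  + split; first exact: closed_borel (@henonJ_closed R al).
    by move=> nu; exact: haar_henonJ.
  + by move=> z zJ n n0; exact: henonJ_aperiodic.
- split.
  + by move=> _ [z z1 <-]; exact: henon_B11.
  + split; first exact: card_balls_third.
    by move=> B; exact: strictly_preperiodic_third.
  + by move=> k _; exact: ball_cycle_level.
  + by move=> k B; exact: card_periodic_subballs.
Qed.
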